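(* Let $\mathscr A\subseteq\mathbb N$ be a weakly subconvex $L^p$-set for some real number $p$ with $1\leq p\leq 4/3$, and let $k\geq 3$ be an integer. Let $(\alpha_0,\alpha_1,\ldots,\alpha_k)\in\mathbb R^{k+1}$, and suppose that $a\in\mathbb Z$ and $q\in\mathbb N$ satisfy $(a,q)=1$ and $|\alpha_k-a/q|\leq 1/q^2$. Then for each $\varepsilon>0$ and each large real number $N$ one has \[ \sum_{n\in\mathscr A(N)}e(\alpha_kn^k+\cdots+\alpha_1n+\alpha_0)\ll N^{1+\varepsilon}\bigl(q^{-1}+N^{-1}+qN^{-k}\bigr)^{2^{1-k}}, \] where the implied constant may depend on $\varepsilon$, $k$, $p$ and $\mathscr A$, but not on $\boldsymbol\alpha$, $a$, $q$ or $N$.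
   Context: For $\mathscr A\subseteq\mathbb N$ and $N\geq 1$ write $\mathscr A(N)=\mathscr A\cap[1,N]$ and $A(N)=\mathrm{card}(\mathscr A(N))$; $e(z)=e^{2\pi i z}$. For $p>0$ put $I_p(N;\mathscr A)=\int_0^1\bigl|\sum_{n\in\mathscr A(N)}e(n\alpha)\bigr|^p\,d\alpha$. A non-empty set $\mathscr A\subseteq\mathbb N$ is a weakly subconvex $L^p$-set if $0<p<2$ and, for every $\varepsilon>0$ and all real $N$ sufficiently large in terms of $p$ and $\varepsilon$, one has $I_p(N;\mathscr A)\ll N^{\varepsilon-1}A(N)^p$ (implied constant independent of $N$). *)

(* Defs.v *)
From mathcomp Require Export all_boot all_order all_algebra.
From mathcomp Require Export all_classical all_reals all_analysis.
From mathcomp Require Export complex finmap.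

Set Implicit Arguments.
Unset Strict Implicit.
Unset Printing Implicit Defensive.

Export Order.TTheory GRing.Theory Num.Theory numFieldNormedType.Exports.

#[export] Set Implicit Arguments.
#[export] Unset Strict Implicit.
#[export] Unset Printing Implicit Defensive.

Local Open Scope classical_set_scope.
Local Open Scope ring_scope.

Section Definitions.
Variable R : realType.
Implicit Types (A : set nat) (N p z : R).

Definition e z : R[i] := Complex (cos (2 * pi * z)) (sin (2 * pi * z)).

Definition cabs (w : R[i]) : R := ComplexField.Normc.normc w.

Definition upto A N : set nat := [set n | A n /\ 1 <= (n%:R : R) <= N].

Definition counting_fun A N : nat := #|` fset_set (upto A N)|.

Definition moment p N A : R :=
  \int[lebesgue_measure]_(x in `[0, 1])
    cabs (\sum_(n \in upto A N) e (n%:R * x)) `^ p.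

(* The natural numbers of the source start at 1, whence the condition that A
   consists of positive integers.  The set A and the exponent p being fixed,
   the threshold N0 and the implied constant C depend only on eps. *)
Definition weakly_subconvex A p : Prop :=
  [/\ A !=set0,
      A `<=` [set n | (0 < n)%N],
      0 < p < 2 &
      forall eps : R, 0 < eps -> exists C N0 : R, forall N : R, N0 <= N ->
        moment p N A <= C * (N `^ (eps - 1) * (counting_fun A N)%:R `^ p)].

Definition real_poly (k : nat) (alpha : 'I_k.+1 -> R) (x : R) : R :=
  \sum_(i < k.+1) alpha i * x ^+ i.

End Definitions.

(* Main.v *)
(* Let K be the exponential sum over A(N) and let g be the Weyl sum over all
   0 <= n <= N, twisted by e(n x).  The sum to be bounded is, by orthogonality,
   the integral of g times the conjugate of K, hence by Hölder at most
   |K|_{4/3} |g|_4.  The first factor is controlled by the hypothesis, since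
   |K|^{4/3} <= A(N)^{4/3-p} |K|^p.  For the second one, |g|^2 is a
   trigonometric polynomial whose h-th coefficient is the exponential sum of the
   difference phi(n + h) - phi(n), so by Parseval the fourth moment of g is a
   sum of squares of exponential sums of degree k - 1.  Averaging over h loses
   nothing, and k - 2 further Weyl differencings reduce it to the classical sum
   of min(M, 1 / ||m alpha_k||) weighted by a divisor function. *)
Require Import Defs.
From mathcomp Require Import all_boot all_order all_algebra.
From mathcomp Require Import all_classical all_reals all_analysis.
From mathcomp Require Import complex finmap.
From mathcomp Require Import ring lra zify.

Local Open Scope classical_set_scope.
Local Open Scope ring_scope.

(** * Complex absolute values, the character [e] and van der Corput's inequality *)

Section ComplexAbs.
Variable R : realType.
Implicit Types (z w : R[i]) (x y : R).

(** The set has no additive structure to difference over; duality moves all differencing to [g],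
    whose range is a full interval. The exponent 4 is the one for which Parseval produces second
    moments of sums of degree [k - 1], and 4/3 is its conjugate; this is why [p <= 4/3] is the range
    in which [|K| <= A(N)] can raise the exponent of the hypothesis. Write [k = n + 3] and
    [V = 1/q + 1/N + q/N^k]. The fourth moment of [g] gains [V^(1/2^n)] over the trivial [N^3], so
    its fourth root gains [V^(1/2^(n+2))], which is the exponent [2^(1-k)] of Weyl's inequality on
    an interval. Up to constants [|K|_{4/3}] is at most [N^(1/4 + 3 eps/4)] and [|g|_4] at most
    [N^(3/4 + eps/4) V^(1/2^(n+2))], and the powers of [N] multiply to exactly [N^(1 + eps)]. The
    range [q > M^k], with [M = truncn N + 1], is split off at the end: the reciprocal sum costs a
    factor [ln q], which a small power of [M] absorbs only when [q] is polynomially bounded, and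
    there the trivial bound suffices. *)

Lemma ReM z w : Re (z * w) = Re z * Re w - Im z * Im w.
Proof. by case: z w => [a b] [c d]. Qed.

Lemma Re_sum (I : Type) (r : seq I) (P : pred I) (F : I -> R[i]) :
  Re (\sum_(i <- r | P i) F i) = \sum_(i <- r | P i) Re (F i).
Proof. by apply: (big_morph (@complex.Re R)) => // -[a b] [c d]. Qed.

Lemma ReJ z : Re (conjc z) = Re z.
Proof. by case: z. Qed.

Lemma ReD z w : Re (z + w) = Re z + Re w.
Proof. by case: z w => [a b] [c d]. Qed.

Lemma cabs_sqr z : cabs z ^+ 2 = Re (z * conjc z).
Proof.
case: z => a b; rewrite /cabs /= sqr_sqrtr ?addr_ge0 ?sqr_ge0 //.
by rewrite mulrN opprK !expr2.
Qed.

Lemma cabs_sqrE z : cabs z ^+ 2 = Re z ^+ 2 + Im z ^+ 2.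
Proof. by case: z => a b; rewrite /cabs /= sqr_sqrtr ?addr_ge0 ?sqr_ge0. Qed.

Lemma cabs_ge0 z : 0 <= cabs z.
Proof. by case: z => a b; exact: sqrtr_ge0. Qed.

Lemma cabs0 : cabs (0 : R[i]) = 0.
Proof. exact: ComplexField.Normc.normc0. Qed.

Lemma cabsM z w : cabs (z * w) = cabs z * cabs w.
Proof. exact: ComplexField.Normc.normcM. Qed.

Lemma cabsD z w : cabs (z + w) <= cabs z + cabs w.
Proof. exact: le_normcD. Qed.

Lemma cabsJ z : cabs (conjc z) = cabs z.
Proof. by case: z => a b; rewrite /cabs /= sqrrN. Qed.

Lemma cabs_sum (I : Type) (r : seq I) (P : pred I) (F : I -> R[i]) :
  cabs (\sum_(i <- r | P i) F i) <= \sum_(i <- r | P i) cabs (F i).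
Proof.
apply: (big_ind2 (fun z x => cabs z <= x)) => //; first by rewrite cabs0.
by move=> z x w y zx wy; apply: le_trans (cabsD _ _) _; exact: lerD.
Qed.

Lemma normr_Re_le_cabs z : `|Re z| <= cabs z.
Proof.
by rewrite -(@ler_pXn2r _ 2) ?nnegrE ?cabs_ge0 // cabs_sqrE -normrX
  ger0_norm ?sqr_ge0 // lerDl sqr_ge0.
Qed.

Lemma Re_le_cabs z : Re z <= cabs z.
Proof. exact: le_trans (ler_norm _) (normr_Re_le_cabs z). Qed.

Lemma eD x y : e (x + y) = e x * e y.
Proof.
by rewrite /e mulrDr cosD sinD; congr Complex; rewrite addrC [X in _ + X]mulrC.
Qed.

Lemma e0 : e (0 : R) = 1.
Proof. by rewrite /e mulr0 cos0 sin0. Qed.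

Lemma eN x : e (- x) = conjc (e x).
Proof. by rewrite /e mulrN cosN sinN. Qed.

Lemma cabs_e x : cabs (e x) = 1.
Proof. by rewrite /cabs /= cos2Dsin2 sqrtr1. Qed.

Lemma eB x y : e (x - y) = e x * conjc (e y).
Proof. by rewrite eD eN. Qed.

(** Pairs of indices are grouped by their difference; the differences [h] and [-h] give conjugate
    terms, whence [2 * Re]. An exact identity is kept because it serves twice: for differencing, and
    for reading off the frequencies of [|g|^2]. *)
Lemma cabs_sqr_sum_shift (z : nat -> R[i]) L :
  cabs (\sum_(i < L) z i) ^+ 2 =
  Re (\sum_(i < L) z i * conjc (z i)) +
  2 * Re (\sum_(1 <= h < L) \sum_(i < L - h) z (i + h)%N * conjc (z i)).
Proof.
elim: L => [|L IH].
  by rewrite !big_ord0 cabs0 big_geq // expr2 /=; ring.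
have -> : \sum_(1 <= h < L.+1)
      \sum_(i < L.+1 - h) z (i + h)%N * conjc (z i) =
    \sum_(1 <= h < L) \sum_(i < L - h) z (i + h)%N * conjc (z i) +
    z L * conjc (\sum_(i < L) z i).
  have -> : \sum_(1 <= h < L) \sum_(i < L - h) z (i + h)%N * conjc (z i) =
      \sum_(1 <= h < L.+1) \sum_(i < L - h) z (i + h)%N * conjc (z i).
    case: L {IH} => [|L]; first by rewrite !big_geq.
    by rewrite [RHS]big_nat_recr //= subnn big_ord0 addr0.
  have -> : z L * conjc (\sum_(i < L) z i) =
      \sum_(1 <= h < L.+1) z L * conjc (z (L - h)%N).
    rewrite rmorph_sum mulr_sumr -(big_mkord xpredT (fun i =>
      z L * conjc (z i))).
    by rewrite big_nat_rev big_add1 /=; apply: eq_bigr => i _; rewrite add0n.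
  rewrite -big_split; apply: eq_big_nat => h /andP[h1 hL].
  rewrite ltnS in hL.
  by rewrite subSn // big_ord_recr /= subnK.
rewrite big_ord_recr cabs_sqr [in RHS]big_ord_recr.
move: IH; rewrite cabs_sqr.
set S := \sum_(i < L) z i; set D := \sum_(i < L) _;
  set E := \sum_(1 <= h < L) _.
rewrite rmorphD /= mulrDr !(mulrDl S) !ReD => ->.
have -> : Re (S * conjc (z L)) = Re (z L * conjc S).
  by rewrite -ReJ rmorphM /= conjcK mulrC.
by ring.
Qed.

Lemma sum_shift_widen (T : zmodType) (F : nat -> nat -> T) (L M : nat) : (L <=
  M)%N ->
  \sum_(1 <= h < L) \sum_(i < L - h) F h i =
  \sum_(1 <= h < M) \sum_(i < L - h) F h i.
Proof.
case: L => [|L] LM.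
  rewrite big_geq // big1 // => h _.
  by rewrite sub0n big_ord0.
rewrite [RHS](@big_cat_nat _ _ _ L.+1) //= [X in _ + X]big_nat.
rewrite [X in _ + X]big1 ?addr0 //.
by move=> h /andP[hL _]; rewrite (eqP hL) big_ord0.
Qed.

(** Shifts [h >= L] contribute empty sums, so the range of [h] can be a fixed [M] while [L] shrinks
    under repeated differencing. *)
Lemma weyl_vdc (z : nat -> R[i]) L M : (L <= M)%N ->
  cabs (\sum_(i < L) z i) ^+ 2 <=
  2 * \sum_(h < M) cabs (\sum_(i < L - h) z (i + h)%N * conjc (z i)).
Proof.
move=> LM; rewrite cabs_sqr_sum_shift
  (sum_shift_widen (fun h i => z (i + h)%N * conjc (z i)) LM).
rewrite [X in 2 * X]Re_sum.
case: M LM => [|M] LM.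
  move: LM; rewrite leqn0 => /eqP ->.
  by rewrite !big_ord0 big_geq // mulr0 addr0.
rewrite -(big_mkord xpredT
  (fun h => cabs (\sum_(i < L - h) z (i + h)%N * conjc (z i)))).
rewrite [in leRHS]big_ltn // subn0.
under [X in cabs X]eq_bigr do rewrite addn0.
have : \sum_(1 <= h < M.+1) Re (\sum_(i < L - h) z (i + h)%N * conjc (z i)) <=
    \sum_(1 <= h < M.+1) cabs (\sum_(i < L - h) z (i + h)%N * conjc (z i)).
  by apply: ler_sum => h _; exact: Re_le_cabs.
set w := \sum_(i < L) _; have := cabs_ge0 w; have := Re_le_cabs w.
by set s1 := \sum_(1 <= h < _) _; set s2 := \sum_(1 <= h < _) _; lra.
Qed.

End ComplexAbs.

(** * Power means with exponents that are powers of two *)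

Section PowerMean.
Variable R : realDomainType.

Lemma ler_exprn n (x y : R) : 0 <= x -> x <= y -> x ^+ n <= y ^+ n.
Proof. by move=> x0 xy; apply: lerXn2r; rewrite ?nnegrE // (le_trans x0). Qed.

Lemma sqr_sum_le (M : nat) (b : nat -> R) :
  (\sum_(h < M) b h) ^+ 2 <= M%:R * \sum_(h < M) b h ^+ 2.
Proof.
elim: M => [|M IH]; first by rewrite !big_ord0 expr2 mulr0.
(* Expanding this bounds the new cross terms [2 * b M * s] by the sum of squares plus
   [M * b M ^+ 2], which is all that the induction step requires. *)
have : 0 <= \sum_(h < M) (b h - b M) ^+ 2.
  by apply: sumr_ge0 => h _; exact: sqr_ge0.
under eq_bigr do rewrite sqrrB.
rewrite big_split sumrB /= sumr_const card_ord -[b M ^+ 2 *+ M]mulr_natl.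
rewrite sumrMnl -mulr_suml !big_ord_recr /= -[M.+1%:R]natr1.
move: IH; set s := \sum_(h < M) b h; set q := \sum_(h < M) _ => IH.
rewrite mulr2n => H; nra.
Qed.

Lemma exp_sum_le (j M : nat) (a : nat -> R) : (forall h, 0 <= a h) ->
  (\sum_(h < M) a h) ^+ (2 ^ j) <=
  M%:R ^+ (2 ^ j).-1 * \sum_(h < M) a h ^+ (2 ^ j).
Proof.
move=> a0; elim: j => [|j IH].
  by rewrite expn0 mul1r expr1; under [leRHS]eq_bigr do rewrite expr1.
have p0 : (0 < 2 ^ j)%N by rewrite expn_gt0.
rewrite expnSr exprM; under [in leRHS]eq_bigr do rewrite exprM.
apply: le_trans (_ : (M%:R ^+ (2 ^ j).-1 * \sum_(h < M) a h ^+ (2 ^ j))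
  ^+ 2 <= _).
  by apply: ler_exprn IH; rewrite exprn_ge0 ?sumr_ge0.
rewrite exprMn -exprM.
have -> : (2 ^ j * 2).-1 = ((2 ^ j).-1 * 2 + 1)%N by lia.
rewrite exprD expr1 -mulrA; apply: ler_wpM2l; first by rewrite exprn_ge0.
exact: (sqr_sum_le M (fun h => a h ^+ (2 ^ j))).
Qed.

End PowerMean.

(** * Iterated Weyl differencing and polynomial phases *)

Section WeylDifferencing.
Variable R : realType.
Implicit Types (f g : nat -> R) (c : R).

Definition expsum f (L : nat) : R[i] := \sum_(i < L) e (f i).

Definition fdiff (h : nat) f : nat -> R := fun i => f (i + h)%N - f i.

(** The sum over all [j]-tuples of shifts of the absolute values of the [j]-fold differenced sums.
    Truncated subtraction makes the length 0 as soon as the shifts exhaust it. *)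
Fixpoint weyl_sum (M j : nat) f (L : nat) : R :=
  if j is j'.+1 then \sum_(h < M) weyl_sum M j' (fdiff h f) (L - h)
  else cabs (expsum f L).

Lemma expsum_vdc f L M : (L <= M)%N ->
  cabs (expsum f L) ^+ 2 <= 2 * \sum_(h < M) cabs (expsum (fdiff h f) (L - h)).
Proof.
move=> LM; apply: le_trans (weyl_vdc (fun i => e (f i)) LM) _.
rewrite ler_pM2l // le_eqVlt; apply/orP; left; apply/eqP.
apply: eq_bigr => h _; congr cabs; apply: eq_bigr => i _.
by rewrite /fdiff eB.
Qed.

(** One van der Corput step, then the power mean over [h] carries the remaining exponent [2 ^ j]
    inside, where the induction hypothesis applies to the differenced phase. The exponent of [M]
    thus grows by [2 ^ j - 1] at each stage, which sums to [2 ^ j - j.+1]. *)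
Lemma weyl_differencing j M f L : (L <= M)%N ->
  cabs (expsum f L) ^+ (2 ^ j) <=
  2 ^+ (2 ^ j).-1 * M%:R ^+ (2 ^ j - j.+1) * weyl_sum M j f L.
Proof.
elim: j f L => [|j IH] f L LM; first by rewrite expn0 subnn !expr0 !mul1r.
have jp : (j < 2 ^ j)%N by exact: ltn_expl.
rewrite expnS exprM.
apply: le_trans (_ : (2 * \sum_(h < M) cabs (expsum (fdiff h f) (L - h)))
  ^+ (2 ^ j) <= _).
  by apply: ler_exprn (expsum_vdc _ LM); rewrite exprn_ge0 ?cabs_ge0.
rewrite exprMn.
apply: le_trans (_ : 2 ^+ (2 ^ j) * (M%:R ^+ (2 ^ j).-1 * \sum_(h < M)
    cabs (expsum (fdiff h f) (L - h)) ^+ (2 ^ j)) <= _).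
  rewrite ler_wpM2l ?exprn_ge0 //.
  apply: (exp_sum_le j M (a := fun h => cabs (expsum (fdiff h f) (L - h)))) =>
    h.
  exact: cabs_ge0.
apply: le_trans (_ : 2 ^+ (2 ^ j) * (M%:R ^+ (2 ^ j).-1 * \sum_(h < M)
   (2 ^+ (2 ^ j).-1 * M%:R ^+ (2 ^ j - j.+1) *
      weyl_sum M j (fdiff h f) (L - h))) <= _).
  rewrite ler_wpM2l ?exprn_ge0 // ler_wpM2l ?exprn_ge0 //.
  by apply: ler_sum => h _; apply: IH; exact: leq_trans (leq_subr _ _) LM.
rewrite -mulr_sumr /=.
have -> : (2 * 2 ^ j).-1 = (2 ^ j + (2 ^ j).-1)%N by lia.
have -> : (2 * 2 ^ j - j.+2 = (2 ^ j).-1 + (2 ^ j - j.+1))%N by lia.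
by rewrite !exprD le_eqVlt; apply/orP; left; apply/eqP; ring.
Qed.

(* [polydiff d c f] says that [f] is a polynomial function of degree at most
   [d] whose coefficient of degree [d] is [c]. *)
Fixpoint polydiff (d : nat) c f : Prop :=
  if d is d'.+1 then forall h, polydiff d' (d%:R * c * h%:R) (fdiff h f)
  else forall i, f i = c.

Lemma polydiffD d c c' f g : polydiff d c f -> polydiff d c' g ->
  polydiff d (c + c') (fun i => f i + g i).
Proof.
elim: d c c' f g => [|d IH] c c' f g /= Hf Hg; first by move=> i; rewrite Hf Hg.
move=> h; have := IH _ _ _ _ (Hf h) (Hg h); rewrite -mulrDl -mulrDr.
congr polydiff; apply/funext => i; rewrite /fdiff; ring.
Qed.

Lemma polydiffZ d a c f : polydiff d c f ->
  polydiff d (a * c) (fun i => a * f i).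
Proof.
elim: d c f => [|d IH] c f /= Hf; first by move=> i; rewrite Hf.
move=> h; have := IH _ _ (Hf h).
by congr polydiff; [ring | apply/funext => i; rewrite /fdiff; ring].
Qed.

Lemma polydiff0 d : polydiff d 0 (fun=> 0).
Proof.
elim: d => [|d IH] //= h; rewrite mulr0 mul0r.
by move: IH; congr polydiff; apply/funext => i; rewrite /fdiff subrr.
Qed.

Lemma polydiff_sum d n (c : nat -> R) (f : nat -> nat -> R) :
  (forall j, (j < n)%N -> polydiff d (c j) (f j)) ->
  polydiff d (\sum_(j < n) c j) (fun i => \sum_(j < n) f j i).
Proof.
elim: n => [|n IH] H.
  rewrite big_ord0; move: (polydiff0 d); congr polydiff.
  by apply/funext => i; rewrite big_ord0.
rewrite big_ord_recr /=.
have := polydiffD (IH (fun j jn => H j (ltnW jn))) (H n (ltnSn n)).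
by congr polydiff; apply/funext => i; rewrite big_ord_recr.
Qed.

Lemma polydiffS d c f : polydiff d c f -> polydiff d.+1 0 f.
Proof.
elim: d c f => [|d IH] c f H h; rewrite mulr0 mul0r.
  by move=> i; rewrite /fdiff !H subrr.
exact: IH (H h).
Qed.

Lemma polydiff_lt d d' c f : (d < d')%N -> polydiff d c f -> polydiff d' 0 f.
Proof.
elim: d' => // d' IH; rewrite ltnS leq_eqVlt => /orP[/eqP <-|dd'] H.
  exact: polydiffS H.
exact: polydiffS (IH dd' H).
Qed.

(** By the binomial theorem the difference is a combination of all lower powers, hence the strong
    induction; only the power just below the top has a leading coefficient that counts, and the
    others enter with coefficient 0. *)
Lemma polydiffXn d : polydiff d 1 (fun i => i%:R ^+ d).
Proof.
elim/ltn_ind: d => -[|d] IH; first by move=> i; rewrite expr0.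
move=> h.
pose t j i : R := h%:R ^+ (d.+1 - j) *+ 'C(d.+1, j) * i%:R ^+ j.
have -> : fdiff h (fun i => i%:R ^+ d.+1) = fun i => \sum_(j < d.+1) t j i.
  apply/funext => i; rewrite /fdiff natrD [i%:R + _]addrC exprDn.
  rewrite big_ord_recr /= subnn expr0 mul1r binn mulr1n.
  rewrite addrK; apply: eq_bigr => j _; rewrite /t.
  by rewrite mulrnAl.
have -> : d.+1%:R * 1 * h%:R =
    \sum_(j < d.+1) (if j == d :> nat then d.+1%:R * h%:R else 0) :> R.
  rewrite big_ord_recr /= eqxx big1 ?add0r ?mulr1 // => j _.
  by rewrite ltn_eqF.
apply: (polydiff_sum (c := fun j =>
  if j == d :> nat then d.+1%:R * h%:R else 0)).
move=> j jd; have := polydiffZ (h%:R ^+ (d.+1 - j) *+ 'C(d.+1, j)) (IH j jd).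
case: eqVneq => [->|jnd].
  congr polydiff; rewrite subSnn expr1 binSn mulr1.
  by rewrite -mulr_natl.
by apply: polydiff_lt; rewrite ltn_neqAle jnd -ltnS.
Qed.

Lemma polydiff_real_poly k (alpha : 'I_k.+1 -> R) :
  polydiff k (alpha ord_max) (fun i => real_poly alpha i%:R).
Proof.
pose a j := alpha (inord j).
have -> : alpha ord_max = \sum_(j < k.+1) (if j == k :> nat then a k else 0).
  rewrite big_ord_recr /= eqxx big1 ?add0r => [|j _]; last by rewrite ltn_eqF.
  by rewrite /a -[k in inord k]/(val (@ord_max k)) inord_val.
have -> : (fun i => real_poly alpha i%:R) =
    fun i : nat => \sum_(j < k.+1) a j * i%:R ^+ j.
  by apply/funext => i; apply: eq_bigr => j _; rewrite /a inord_val.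
apply: (polydiff_sum (c := fun j => if j == k :> nat then a k else 0)
  (f := fun j i => a j * i%:R ^+ j)) => j jk.
have := polydiffZ (a j) (polydiffXn j).
case: eqVneq => [->|jnk]; first by rewrite mulr1.
by apply: polydiff_lt; rewrite ltn_neqAle jnk -ltnS.
Qed.

Lemma polydiff1 c f : polydiff 1 c f -> forall i, f i = f 0%N + c * i%:R.
Proof.
move=> /= H i; have := H i 0%N; rewrite /fdiff add0n mul1r => <-; ring.
Qed.

End WeylDifferencing.

(** * Sums over products of shifts *)

Section ProductSums.
Variable R : realType.

Fixpoint prodsum (F : nat -> R) (M j m : nat) : R :=
  if j is j'.+1 then \sum_(h < M) prodsum F M j' (m * h) else F m.

(** Differencing by [h] in degree [d] multiplies the leading coefficient by [d * h]. The degrees met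
    on the way down to 1 are [j + 1, ..., 2], so the final slope is [(j + 1)!] times the product of
    the shifts times [m * al]; the free multiplier [m] carries the induction. *)
Lemma weyl_sum_le_prodsum (F : nat -> R) (al : R) M :
  (forall m f L, (L <= M)%N -> polydiff 1 (m%:R * al) f ->
    cabs (expsum f L) <= F m) ->
  forall j m f L, (L <= M)%N -> polydiff j.+1 (m%:R * al) f ->
    weyl_sum M j f L <= prodsum F M j (j.+1`! * m).
Proof.
move=> HF; elim=> [|j IH] m f L LM Hf.
  by rewrite (_ : 1`! = 1)%N // mul1n; apply: HF.
apply: ler_sum => h _.
have -> : ((j.+2)`! * m * h = (j.+1)`! * (j.+2 * m * h))%N.
  by rewrite [in LHS]factS; lia.
apply: IH; first exact: leq_trans (leq_subr _ _) LM.
suff -> : (j.+2 * m * h)%:R * al = j.+2%:R * (m%:R * al) * h%:R by exact: Hf.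
by rewrite !natrM; ring.
Qed.

Variables (F : nat -> R) (M : nat).
Hypothesis F_ge0 : forall m, 0 <= F m.
Hypothesis F0 : F 0%N <= M%:R.

Lemma prodsum_ge0 j m : 0 <= prodsum F M j m.
Proof. by elim: j m => //= j IH m; apply: sumr_ge0 => h _; exact: IH. Qed.

Lemma prodsum0 j : prodsum F M j 0 <= M%:R ^+ j.+1.
Proof.
elim: j => [|j IH] /=; first by rewrite expr1.
rewrite (eq_bigr (fun=> prodsum F M j 0)) => [|h _]; last by rewrite mul0n.
by rewrite sumr_const card_ord -(mulr_natl (prodsum F M j 0)) exprS ler_wpM2l.
Qed.

Lemma sum_dvd_le X m : (0 < m)%N ->
  (\sum_(1 <= c < X.+1) (c %| m : nat) <= size (divisors m))%N.
Proof.
move=> m0; rewrite -big_mkcond /= sum1_count -size_filter.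
apply: uniq_leq_size; first by rewrite filter_uniq // iota_uniq.
by move=> c; rewrite mem_filter -dvdn_divisors // => /andP[].
Qed.

(** An integer [m] arises as [c * h] at most once for each of its divisors [c]. *)
Lemma sum_mul_le_divisors (G : nat -> R) (D : R) X Y : (forall m, 0 <= G m) ->
  (forall m, (0 < m <= X * Y)%N -> (size (divisors m))%:R <= D) ->
  \sum_(1 <= c < X.+1) \sum_(1 <= h < Y.+1) G (c * h)%N <=
  D * \sum_(1 <= m < (X * Y).+1) G m.
Proof.
move=> G0 HD.
have step c h : (0 < c <= X)%N -> (0 < h <= Y)%N ->
    G (c * h)%N = \sum_(1 <= m < (X * Y).+1) (c * h == m)%N%:R * G m.
  move=> cX hY; rewrite (bigD1_seq (c * h)%N) ?iota_uniq //=; last first.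
    by rewrite mem_index_iota; nia.
  rewrite eqxx mul1r big1 ?addr0 // => m; rewrite eq_sym => /negPf ->.
  by rewrite mul0r.
rewrite (eq_big_nat _ _ (F2 := fun c => \sum_(1 <= m < (X * Y).+1)
    (\sum_(1 <= h < Y.+1) (c * h == m)%N)%:R * G m)); last first.
  move=> c cX; rewrite (eq_big_nat _ _ (F2 := fun h => \sum_(1 <=
    m < (X * Y).+1)
    (c * h == m)%N%:R * G m)); last by move=> h hY; apply: step.
  by rewrite exchange_big; apply: eq_bigr => m _; rewrite natr_sum mulr_suml.
rewrite exchange_big mulr_sumr !big_nat; apply: ler_sum => m mXY /=.
rewrite -mulr_suml ler_wpM2r //; apply: le_trans (HD m mXY).
rewrite -natr_sum ler_nat; apply: leq_trans (sum_dvd_le X _);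
  last by case/andP: mXY.
rewrite !big_nat; apply: leq_sum => c /andP[c0 _].
case: (boolP (c %| m)%N) => [/dvdnP[t ->]|ndvd]; last first.
  rewrite big1 // => h _; case: eqP => // mE.
  by rewrite -mE dvdn_mulr in ndvd.
rewrite (eq_bigr (fun h => (h == t : nat))) => [|h _]; last first.
  by rewrite mulnC eqn_pmul2r.
rewrite -big_mkcond /= sum1_count count_uniq_mem ?iota_uniq //.
by case: (_ \in _).
Qed.

(** Shifts are absorbed one at a time: [c * h] becomes the new outer variable, with range [X * M],
    at the cost of a factor [D]. A zero shift annihilates the whole product and is bounded
    trivially; the [j] levels together yield the term [j * X * M ^ j]. The sum over [c] is there for
    this induction. *)
Lemma sum_prodsum_le (D : R) j X : (0 < M)%N -> 1 <= D ->
  (forall m, (0 < m <= X * M ^ j)%N -> (size (divisors m))%:R <= D) ->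
  \sum_(1 <= c < X.+1) prodsum F M j c <=
  D ^+ j * (\sum_(1 <= m < (X * M ^ j).+1) F m + (j * X * M ^ j)%:R).
Proof.
move=> M0 D1; elim: j X => [|j IH] X HD.
  by rewrite expn0 muln1 expr0 mul1r !mul0n addr0.
have Dge0 : 0 <= D by apply: le_trans D1.
have := IH (X * M)%N; rewrite -mulnA -expnS => /(_ HD) {}IH.
(* The shift 0 is split off, and [h = M] is added so that the positive shifts fill the interval from
   1 to [M]. *)
apply: le_trans (_ : \sum_(1 <= c < X.+1) (M%:R ^+ j.+1 +
    \sum_(1 <= h < M.+1) prodsum F M j (c * h)) <= _).
  apply: ler_sum => c _ /=.
  rewrite -(big_mkord xpredT (fun h => prodsum F M j (c * h))) big_ltn // muln0.
  apply: lerD (prodsum0 _) _.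
  by rewrite [leRHS]big_nat_recr //= lerDl prodsum_ge0.
rewrite big_split /= sumr_const_nat subn1 /=.
have HD' m : (0 < m <= X * M)%N -> (size (divisors m))%:R <= D.
  move=> /andP[m0 mX]; apply: HD; rewrite m0 (leq_trans mX) // leq_mul2l.
  by rewrite expnS leq_pmulr ?orbT // expn_gt0 M0.
have := sum_mul_le_divisors (prodsum_ge0 j) HD'.
set s := \sum_(1 <= c < X.+1) _ => Hs.
have {}Hs := le_trans Hs (ler_wpM2l Dge0 IH).
rewrite -[M%:R ^+ j.+1 *+ X]mulr_natr -natrX -natrM mulnC.
have D' : 1 <= D ^+ j.+1 by exact: exprn_ege1.
have -> : (j.+1 * X * M ^ j.+1)%:R =
    (X * M ^ j.+1)%:R + (j * (X * M) * M ^ j)%:R :> R.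
  by rewrite -natrD; congr (_%:R); rewrite expnS; lia.
apply: le_trans (lerD (lexx _) Hs) _; rewrite mulrA -exprS.
set E := D ^+ _ in D' *; set Z := (X * _)%:R; set J := (_ * _)%:R.
have ZE : Z <= E * Z by rewrite ler_peMl.
by rewrite !mulrDr; lra.
Qed.

End ProductSums.

(** * The divisor function is smaller than any power *)

Section DivisorBound.

(** A divisor [d] is recovered from [gcdn d m] and its cofactor, and the cofactor divides [n]
    because it is coprime to [m %/ gcdn d m]. *)
Lemma size_divisorsM m n : (0 < m)%N -> (0 < n)%N ->
  (size (divisors (m * n)) <= size (divisors m) * size (divisors n))%N.
Proof.
move=> m0 n0; rewrite -(size_allpairs muln).
apply: (uniq_leq_size (divisors_uniq _)) => d.
rewrite -dvdn_divisors ?muln_gt0 ?m0 // => d_mn.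
have g0 : (0 < gcdn d m)%N by rewrite gcdn_gt0 m0 orbT.
apply/allpairsP; exists (gcdn d m, d %/ gcdn d m)%N; split => /=.
- by rewrite -dvdn_divisors // dvdn_gcdr.
- rewrite -dvdn_divisors //.
  rewrite -(@Gauss_dvdr _ (m %/ gcdn d m)); last first.
    rewrite /coprime -(eqn_pmul2r g0) muln_gcdl mul1n.
    by rewrite !divnK ?dvdn_gcdl ?dvdn_gcdr.
  rewrite -(dvdn_pmul2r g0) divnK ?dvdn_gcdl //.
  by rewrite mulnAC divnK ?dvdn_gcdr.
- by rewrite mulnC divnK // dvdn_gcdl.
Qed.

Lemma size_divisors_pexp p a : prime p -> (size (divisors (p ^ a)) <= a.+1)%N.
Proof.
move=> pp; rewrite -[a.+1](size_iota 0) -[leqRHS](size_map (expn p)).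
apply: (uniq_leq_size (divisors_uniq _)) => d.
rewrite -dvdn_divisors ?expn_gt0 ?prime_gt0 // => /dvdn_pfactor -/(_ pp)
  [b ba ->].
by apply: map_f; rewrite mem_iota.
Qed.

(** For small [p] the point is that [a + 1 <= r * (a %/ r + 1) <= r * 2 ^ (a %/ r)], whose [r]-th
    power is at most [r ^ r * 2 ^ a]. *)
Lemma succ_exp_le r a p : (0 < r)%N -> (1 < p)%N ->
  (a.+1 ^ r <= (if p < 2 ^ r then r ^ r else 1) * p ^ a)%N.
Proof.
move=> r0 p1.
have mono x y m : (x <= y)%N -> (x ^ m <= y ^ m)%N.
  by case: m => // m xy; rewrite leq_exp2r.
case: ltnP => [_|rp]; last first.
  rewrite mul1n; apply: leq_trans (_ : (2 ^ r) ^ a <= _)%N; last exact: mono.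
  by rewrite -expnM mulnC expnM leq_exp2r // ltn_expl.
apply: leq_trans (_ : r ^ r * 2 ^ a <= _)%N; last first.
  by rewrite leq_mul2l mono ?orbT.
apply: leq_trans (_ : (r * (a %/ r).+1) ^ r <= _)%N.
  by rewrite leq_exp2r // mulnC ltn_ceil.
rewrite expnMn leq_mul2l; apply/orP; right.
apply: leq_trans (_ : (2 ^ (a %/ r)) ^ r <= _)%N.
  by rewrite leq_exp2r // ltn_expl.
by rewrite -expnM leq_exp2l // leq_divM.
Qed.

(* Comparing prime by prime: [(a + 1)^r <= p^a] as soon as [2^r <= p], and each
   of the fewer than [2^r] smaller primes costs a factor [r^r]. *)
Lemma divisor_bound r n : (0 < r)%N -> (0 < n)%N ->
  (size (divisors n) ^ r <= (r ^ r) ^ (2 ^ r) * n)%N.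
Proof.
move=> r0 n0.
pose b p := if (p < 2 ^ r)%N then (r ^ r)%N else 1%N.
have H (s : seq nat) : {in s, forall p, prime p} ->
    (size (divisors (\prod_(p <- s) p ^ logn p n)) ^ r <=
     \prod_(p <- s) b p * \prod_(p <- s) p ^ logn p n)%N.
  elim: s => [|p s IH] sP; first by rewrite !big_nil exp1n.
  have pp : prime p by apply: sP; rewrite mem_head.
  have {}IH := IH (fun q qs => sP q (mem_behead (s := p :: s) qs)).
  rewrite !big_cons; set P := (\prod_(q <- s) q ^ _)%N in IH *.
  have P0 : (0 < P)%N.
    rewrite /P big_seq; apply: prodn_cond_gt0 => q qs.
    by rewrite expn_gt0 prime_gt0 // sP // in_cons qs orbT.
  apply: leq_trans (_ : ((logn p n).+1 * size (divisors P)) ^ r <= _)%N.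
    rewrite leq_exp2r //; apply: leq_trans (size_divisorsM _ P0) _.
      by rewrite expn_gt0 prime_gt0.
    by rewrite leq_mul2r size_divisors_pexp ?orbT.
  rewrite expnMn mulnACA leq_mul //.
  by rewrite succ_exp_le // prime_gt1.
have nE : (\prod_(p <- primes n) p ^ logn p n)%N = n.
  rewrite [RHS]prod_prime_decomp // prime_decompE big_map.
  by apply: eq_bigr.
have := H (primes n); rewrite nE => /(_ _)/leq_trans; apply.
  by move=> p; rewrite mem_primes => /andP[].
rewrite leq_mul2r; apply/orP; right.
rewrite /b -big_mkcond /= big_const_seq iter_muln_1.
apply: leq_pexp2l; first by rewrite expn_gt0 r0.
rewrite -size_filter -[leqRHS](size_iota 0); apply: uniq_leq_size.
  by rewrite filter_uniq // primes_uniq.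
by move=> p; rewrite mem_filter mem_iota => /andP[].
Qed.

End DivisorBound.

(** * Distance to the nearest integer and linear exponential sums *)

Section DistanceToIntegers.
Variable R : realType.
Implicit Types (x y c : R).

Definition dist_int x : R :=
  Num.min (x - (Num.floor x)%:~R) (1 - (x - (Num.floor x)%:~R)).

Lemma dist_int_ge0 x : 0 <= dist_int x.
Proof.
have /andP[h1 h2] := floor_itv x; rewrite intrD in h2.
by rewrite /dist_int le_min; apply/andP; split; lra.
Qed.

Lemma dist_int_eq (t : int) x y : x = t%:~R + y -> 0 <= y < 1 ->
  dist_int x = Num.min y (1 - y).
Proof.
move=> xE /andP[y0 y1]; rewrite /dist_int.
have -> : Num.floor x = t.
  by apply/floor_def; rewrite intrD xE; apply/andP; split; lra.
by rewrite xE addrC addKr.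
Qed.

Lemma e_int (t : int) x : e (t%:~R + x) = e x.
Proof.
have e1 y : e (1 + y) = e y.
  by rewrite eD /e mulr1 mulr_natl cos2pi sin2pi mul1r.
have en (n : nat) y : e (n%:R + y) = e y.
  by elim: n y => [|n IH] y; rewrite ?add0r // -natr1 -addrA IH e1.
case: t => n; first exact: en.
by rewrite -[LHS](en n.+1) NegzE mulrNz; congr e; exact: addNKr.
Qed.

(** The mean value theorem on [[0, y/2]] gives [sin (y/2) >= (y/2) * cos (y/2)]. Hence [sin y >= y *
    cos (y/2) ^+ 2 = y * (1 + cos y) / 2], and [cos y >= 0]. *)
Lemma sin_ge_half y : 0 <= y <= pi / 2 -> y / 2 <= sin y.
Proof.
move=> /andP[y0 yp]; have pi0 := pi_gt0 R.
have [->|yn0] := eqVneq y 0; first by rewrite mul0r sin0.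
have ypos : 0 < y by rewrite lt_neqAle eq_sym yn0.
have [xi xiI sE] : exists2 xi, xi \in `]0, y / 2[ &
    sin (y / 2) - sin 0 = cos xi * (y / 2 - 0).
  apply: (@MVT R sin cos); first by rewrite divr_gt0.
  by apply: continuous_subspaceT; exact: continuous_sin.
rewrite sin0 !subr0 in sE; move: xiI; rewrite in_itv /= => /andP[xi0 xiy].
have cc : cos (y / 2) <= cos xi.
  rewrite ltW // ltr_cos ?in_itv //=; apply/andP; split; lra.
have c0 : 0 <= cos (y / 2) by apply: cos_ge0_pihalf; apply/andP; split; lra.
have cy : 0 <= cos y by apply: cos_ge0_pihalf; apply/andP; split; lra.
have yE : y = (y / 2) *+ 2 by rewrite mulr2n; lra.
have sy : sin y = cos (y / 2) * sin (y / 2)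
  *+ 2 by rewrite [in LHS]yE sin_mulr2n.
have cyE : cos y = cos (y / 2) ^+ 2 *+ 2 - 1 by rewrite [in LHS]yE cos_mulr2n.
rewrite sy sE.
move: cyE cy c0 cc; set u := cos (y / 2); set v := cos xi.
rewrite expr2 => -> cy u0 uv.
have : 0 <= y * (u * (v - u)) by rewrite !mulr_ge0 // subr_ge0.
have : 0 <= y * (u * u + u * u - 1) by rewrite mulr_ge0 // ltW.
lra.
Qed.

(** With [x] the fractional part of [c], the right side is [2 * sin (pi * x)]. For [x <= 1/2] the
    sine is at least [pi * x / 2 >= x], since [pi >= 2]; otherwise reflect [x] to [1 - x]. *)
Lemma dist_int_le_cabs_1Be c : 2 * dist_int c <= cabs (1 - e c).
Proof.
have [x cE /andP[x0 x1]] : exists2 x, c = (Num.floor c)%:~R + x & 0 <= x < 1.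
  exists (c - (Num.floor c)%:~R); first by rewrite addrC subrK.
  have /andP[h1 h2] := floor_itv c; rewrite intrD in h2.
  by apply/andP; split; lra.
have -> : e c = e x by rewrite [in LHS]cE e_int.
have -> : dist_int c = Num.min x (1 - x).
  by apply: (dist_int_eq cE); rewrite x0 x1.
have pi0 := pi_gt0 R; have pi2 := pi_ge2 R.
have sx : Num.min x (1 - x) <= sin (pi * x).
  rewrite ge_min; case: (lerP x (1 / 2)) => xh.
    apply/orP; left; apply: le_trans (sin_ge_half _); first by nra.
    by apply/andP; split; nra.
  apply/orP; right.
  have -> : sin (pi * x) = sin (pi * (1 - x)).
    by rewrite mulrBr mulr1 addrC sinDpi sinN opprK.
  apply: le_trans (sin_ge_half _); first by nra.
  by apply/andP; split; nra.
have s0 : 0 <= sin (pi * x) by apply: sin_ge0_pi; apply/andP; split; nra.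
rewrite -(@ler_pXn2r _ 2) ?nnegrE ?cabs_ge0 //; last first.
  by rewrite mulr_ge0 // le_min x0 subr_ge0 ltW.
apply: le_trans (_ : (2 * sin (pi * x)) ^+ 2 <= _).
  by apply: ler_exprn; rewrite ?ler_pM2l // mulr_ge0 // le_min x0 subr_ge0 ltW.
rewrite cabs_sqrE /= (_ : 2 * pi * x = (pi * x) *+ 2); last by rewrite mulr2n;
  ring.
rewrite cos_mulr2n sin_mulr2n.
have := cos2Dsin2 (pi * x); set u := cos _; set v := sin _ => uv.
have vE : v * v = 1 - u * u by rewrite -uv; ring.
have E1 : (2 * v) ^+ 2 = 4 * (v * v) by ring.
have -> : (1 - (u ^+ 2 *+ 2 - 1)) ^+ 2 + (0 - u * v *+ 2) ^+ 2 =
    4 * ((1 - u * u) * (1 - u * u)) + 4 * (u * u) * (v * v) by ring.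
by rewrite E1 vE le_eqVlt; apply/orP; left; apply/eqP; ring.
Qed.

(** This is [min(M, 1/||x||)]. The test is on the product because the inverse of 0 is 0 by
    convention, whereas the value at an integer has to be [M]. *)
Definition geom_bound (M x : R) : R :=
  if M * dist_int x <= 1 then M else (dist_int x)^-1.

Lemma geom_bound_ge0 (M x : R) : 0 <= M -> 0 <= geom_bound M x.
Proof. by rewrite /geom_bound; case: ifP => // _ _;
  rewrite invr_ge0 dist_int_ge0. Qed.

Lemma geom_bound_le (M x : R) : geom_bound M x <= M.
Proof.
rewrite /geom_bound; case: (lerP (M * _)) => // H.
have d0 : 0 < dist_int x.
  have := dist_int_ge0 x; rewrite le_eqVlt => /orP[/eqP d0|//].
  by move: H; rewrite -d0 mulr0; lra.
by rewrite -[_^-1]mul1r ler_pdivrMr // ltW.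
Qed.

Lemma geom_bound_le_inv (M x d : R) : 0 < d -> d <= dist_int x ->
  geom_bound M x <= d^-1.
Proof.
move=> d0 dx; rewrite /geom_bound; have dp := lt_le_trans d0 dx.
case: (lerP (M * _)) => H; last by rewrite lef_pV2.
apply: le_trans (_ : (dist_int x)^-1 <= _); last by rewrite lef_pV2.
by rewrite -[_^-1]mul1r ler_pdivlMr.
Qed.

Lemma cabs_expsum_le (f : nat -> R) L : cabs (expsum f L) <= L%:R.
Proof.
apply: le_trans (cabs_sum _ _ _) _.
by rewrite (eq_bigr (fun=> 1)) => [|i _]; rewrite ?sumr_const ?card_ord ?cabs_e.
Qed.

Lemma expsum_linear_le (c : R) (f : nat -> R) (L M : nat) : (L <= M)%N ->
  polydiff 1 c f -> cabs (expsum f L) <= geom_bound M%:R c.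
Proof.
move=> LM /polydiff1 fE; rewrite /geom_bound; case: (lerP (M%:R * _)) => H.
  by apply: le_trans (cabs_expsum_le _ _) _; rewrite ler_nat.
have d0 : 0 < dist_int c.
  have := dist_int_ge0 c; rewrite le_eqVlt => /orP[/eqP d0|//].
  by move: H; rewrite -d0 mulr0; lra.
have geo : expsum f L * (1 - e c) = e (f 0%N) - e (f L).
  rewrite mulrBr mulr1 /expsum mulr_suml -sumrB.
  rewrite (eq_bigr (fun i : 'I_L => - (e (f i.+1) - e (f i)))) => [|i _].
    rewrite sumrN -(big_mkord xpredT (fun i => e (f i.+1) - e (f i))).
    by rewrite telescope_sumr // opprB.
  by rewrite opprB -eD !(fE i) (fE i.+1) -natr1; congr (_ - e _); ring.
rewrite -[_^-1]mul1r ler_pdivlMr //.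
have : cabs (expsum f L) * cabs (1 - e c) <= 2.
  rewrite -cabsM geo; apply: le_trans (cabsD _ _) _.
  by rewrite /cabs normcN -!/(cabs _) !cabs_e.
have := dist_int_le_cabs_1Be c; have := cabs_ge0 (expsum f L).
by set u := cabs _; set v := cabs _; nra.
Qed.

End DistanceToIntegers.

(** * Trigonometric polynomials on the unit interval and Parseval's identity *)

Section TrigPolynomials.
Variable R : realType.
Implicit Types (x : R) (u v : nat -> R[i]).
Local Notation mu := (@lebesgue_measure R).
Local Notation I01 := (`[0%R, 1%R]%classic : set R).

Lemma continuous_integrable01 (f : R -> R) : continuous f ->
  mu.-integrable I01 (EFin \o f).
Proof.
move=> fc; apply: continuous_compact_integrable; first exact: segment_compact.
exact: continuous_subspaceT.
Qed.

Lemma continuous_sumr (I : Type) (r : seq I) (f : I -> R -> R) :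
  (forall i, continuous (f i)) -> continuous (fun x => \sum_(i <- r) f i x).
Proof.
move=> fc; elim: r => [|i r IH].
  rewrite (_ : (fun _ => _) = fun=> 0); first by move=> x; exact: cvg_cst.
  by apply/funext => x; rewrite big_nil.
rewrite (_ : (fun _ => _) = fun x => f i x + \sum_(i <- r) f i x).
  by move=> x; apply: cvgD; [exact: fc|exact: IH].
by apply/funext => x; rewrite big_cons.
Qed.

Lemma eq_Rintegral01 (f g : R -> R) : f =1 g ->
  \int[mu]_(x in I01) f x = \int[mu]_(x in I01) g x.
Proof. by move=> fg; apply: eq_Rintegral => x _; exact: fg. Qed.

Lemma Rintegral_sum (I : Type) (r : seq I) (f : I -> R -> R) :
  (forall i, continuous (f i)) ->
  \int[mu]_(x in I01) (\sum_(i <- r) f i x) =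
  \sum_(i <- r) \int[mu]_(x in I01) f i x.
Proof.
move=> fc; elim: r => [|i r IH].
  rewrite big_nil (eq_Rintegral01 (g := fun=> 0)).
    by rewrite Rintegral_cst // mul0r.
  by move=> x; rewrite big_nil.
rewrite big_cons -IH -RintegralD //.
- by apply: eq_Rintegral => x _; rewrite big_cons.
- exact: continuous_integrable01.
- by apply: continuous_integrable01; exact: continuous_sumr.
Qed.

Lemma Re_mul_eE (w : R[i]) (c x : R) :
  Re (w * e (c * x)) =
  Re w * cos (2 * pi * c * x) - Im w * sin (2 * pi * c * x).
Proof. by rewrite ReM /= mulrA. Qed.

Lemma continuous_Re_mul_e (w : R[i]) (c : R) :
  continuous (fun x => Re (w * e (c * x))).
Proof.
rewrite (_ : (fun _ => _) = fun x =>
  Re w * cos (2 * pi * c * x) - Im w * sin (2 * pi * c * x)); last first.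
  by apply/funext => x; exact: Re_mul_eE.
move=> x; apply: cvgB; apply: cvgMr.
  by apply: continuous_comp; [exact: mulrl_continuous|exact: continuous_cos].
by apply: continuous_comp; [exact: mulrl_continuous|exact: continuous_sin].
Qed.

Lemma Rintegral_Re_mul_e (w : R[i]) (l : int) :
  \int[mu]_(x in I01) Re (w * e (l%:~R * x)) = if l == 0 then Re w else 0.
Proof.
case: eqVneq => [->|l0].
  rewrite (eq_Rintegral01 (g := fun=> Re w)) => [|x].
    by rewrite Rintegral_cst //= lebesgue_measure_itv /= lte01 sube0 mulr1.
  by rewrite mul0r e0 mulr1.
pose om : R := 2 * pi * l%:~R.
have om0 : om != 0 by rewrite !mulf_neq0 ?intr_eq0 // gt_eqF // pi_gt0.
(* An antiderivative of the integrand; it has period 1, so the integral vanishes. *)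
pose F x := om^-1 * (Re w * sin (om * x) + Im w * cos (om * x)).
have dF x : is_derive x 1 F (Re (w * e (l%:~R * x))).
  have dm : is_derive x 1 ( *%R om) om.
    by have := is_deriveZ om (is_derive_id x (1 : R));
      rewrite /GRing.scale /= mulr1.
  have ds := is_derive1_comp (is_derive_sin (om * x)) dm.
  have dc := is_derive1_comp (is_derive_cos (om * x)) dm.
  have H := is_deriveZ om^-1
    (is_deriveD (is_deriveZ (Re w) ds) (is_deriveZ (Im w) dc)).
  refine (is_derive_eq H _).
  by rewrite Re_mul_eE -/om /GRing.scale /=; field.
have FE : F 1 = F 0.
  rewrite /F mulr1 mulr0 sin0 cos0; have := e_int l (0 : R); rewrite e0 addr0.
  by move=> [cE sE]; rewrite /om cE sE.
rewrite /Rintegral (continuous_FTC2 (F := F)) //=.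
- by rewrite FE subrr.
- by apply: continuous_subspaceT; exact: continuous_Re_mul_e.
- split=> [x _||]; first by case: (dF x).
    by apply: cvg_at_right_filter; apply: differentiable_continuous;
      apply/derivable1_diffP; case: (dF 0).
  by apply: cvg_at_left_filter; apply: differentiable_continuous;
      apply/derivable1_diffP; case: (dF 1).
- by move=> x _; rewrite derive1E; case: (dF x).
Qed.

Lemma conjcM (z w : R[i]) : conjc (z * w) = conjc z * conjc w.
Proof. exact: rmorphM. Qed.

Lemma conjc_sum (I : Type) (r : seq I) (P : pred I) (F : I -> R[i]) :
  conjc (\sum_(i <- r | P i) F i) = \sum_(i <- r | P i) conjc (F i).
Proof. exact: rmorph_sum. Qed.

Definition trigpoly u (M : nat) x : R[i] := \sum_(n < M) u n * e (n%:R * x).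

Lemma Re_trigpolyM_conj u v M x :
  Re (trigpoly u M x * conjc (trigpoly v M x)) =
  \sum_(n < M) \sum_(m < M)
    Re (u n * conjc (v m) * e ((n%:Z - m%:Z)%:~R * x)).
Proof.
rewrite /trigpoly mulr_suml Re_sum; apply: eq_bigr => n _.
rewrite conjc_sum mulr_sumr Re_sum; apply: eq_bigr => m _.
rewrite conjcM intrB -!pmulrn mulrBl eB; congr Re; ring.
Qed.

Lemma continuous_Re_trigpolyM_conj u v M :
  continuous (fun x => Re (trigpoly u M x * conjc (trigpoly v M x))).
Proof.
rewrite (_ : (fun _ => _) = fun x => \sum_(n < M) \sum_(m < M)
    Re (u n * conjc (v m) * e ((n%:Z - m%:Z)%:~R * x))); last first.
  by apply/funext => x; exact: Re_trigpolyM_conj.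
apply: (continuous_sumr (f := fun (n : 'I_M) x => \sum_(m < M) _)) => n.
by apply: continuous_sumr => m; exact: continuous_Re_mul_e.
Qed.

(** The bilinear form covers both uses: [u = v] for the fourth moment, and two different sequences
    for the duality pairing. Real parts keep every integral real-valued. *)
Lemma parseval u v M :
  \int[mu]_(x in I01) Re (trigpoly u M x * conjc (trigpoly v M x)) =
  \sum_(n < M) Re (u n * conjc (v n)).
Proof.
rewrite (eq_Rintegral01 (g := fun x => \sum_(n < M) \sum_(m < M)
    Re (u n * conjc (v m) * e ((n%:Z - m%:Z)%:~R * x)))) => [|x]; last first.
  exact: Re_trigpolyM_conj.
rewrite (Rintegral_sum _ (f := fun (n : 'I_M) x => \sum_(m < M)
    Re (u n * conjc (v m) * e ((n%:Z - m%:Z)%:~R * x)))) => [|n]; last first.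
  by apply: continuous_sumr => m; exact: continuous_Re_mul_e.
apply: eq_bigr => n _.
rewrite (Rintegral_sum _ (f := fun (m : 'I_M) x =>
    Re (u n * conjc (v m) * e ((n%:Z - m%:Z)%:~R * x)))) => [|m]; last first.
  exact: continuous_Re_mul_e.
under eq_bigr do rewrite Rintegral_Re_mul_e subr_eq0.
rewrite (bigD1 n) //= eqxx big1 ?addr0 // => m mn.
by rewrite eqz_nat val_eqE eq_sym (negPf mn).
Qed.

Lemma continuous_cabs_trigpoly u M : continuous (fun x =>
  cabs (trigpoly u M x)).
Proof.
rewrite (_ : (fun _ => _) = fun x =>
    Num.sqrt (Re (trigpoly u M x * conjc (trigpoly u M x)))); last first.
  by apply/funext => x; rewrite -cabs_sqr sqrtr_sqr ger0_norm ?cabs_ge0.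
move=> x; apply: continuous_comp; last exact: sqrt_continuous.
exact: continuous_Re_trigpolyM_conj.
Qed.

Lemma cabs_trigpoly_le u M x : cabs (trigpoly u M x) <= \sum_(n < M) cabs (u n).
Proof.
apply: le_trans (cabs_sum _ _ _) _; apply: ler_sum => n _.
by rewrite cabsM cabs_e mulr1.
Qed.

Lemma integrable_cabs_trigpoly_powR u M (p : R) : 0 <= p ->
  mu.-integrable I01 (EFin \o (fun x => cabs (trigpoly u M x) `^ p)).
Proof.
move=> p0; apply: measurable_bounded_integrable => //.
- by rewrite /= lebesgue_measure_itv /= lte01 sube0 ltry.
- apply: measurable_funTS.
  apply: (measurableT_comp (measurable_realfun.measurable_powR p)).
  by apply: measurable_realfun.continuous_measurable_fun;
    exact: continuous_cabs_trigpoly.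
- exists ((\sum_(n < M) cabs (u n)) `^ p); split; first exact: num_real.
  move=> y y0 x _ /=; rewrite ger0_norm ?powR_ge0 // (le_trans _ (ltW y0)) //.
  apply: ge0_ler_powR; rewrite ?nnegrE ?cabs_ge0 ?cabs_trigpoly_le //.
  by apply: sumr_ge0 => n _; exact: cabs_ge0.
Qed.

(* [|g|^2] is the real part of a trigonometric polynomial whose coefficients
   are the differenced exponential sums; Parseval applies to the latter. *)
Lemma fourth_moment_le (f : nat -> R) (M : nat) :
  \int[mu]_(x in I01) cabs (trigpoly (fun i => e (f i)) M x) ^+ 4 <=
  4 * \sum_(h < M) cabs (expsum (fdiff h f) (M - h)) ^+ 2.
Proof.
pose s h := expsum (fdiff h f) (M - h).
(* Taking real parts folds the negative frequencies onto the positive ones. The resulting factor 2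
   becomes the constant 4 after squaring. *)
pose p h : R[i] := if h == 0%N then s h else 2 * s h.
have gE x : cabs (trigpoly (fun i => e (f i)) M x) ^+ 2 = Re (trigpoly p M x).
  rewrite {1}/trigpoly (cabs_sqr_sum_shift (fun i => e (f i) * e (i%:R * x))).
  have sE h : \sum_(i < M - h) e (f (i + h)%N) * e ((i + h)%:R * x) *
      conjc (e (f i) * e (i%:R * x)) = s h * e (h%:R * x).
    rewrite /s /expsum mulr_suml; apply: eq_bigr => i _.
    rewrite /fdiff eB natrD mulrDl eD conjcM.
    have ee : e (i%:R * x) * conjc (e (i%:R * x)) = 1 by rewrite -eB subrr e0.
    by rewrite -[RHS]mulr1 -ee; ring.
  rewrite /trigpoly; have [M0|M0] := posnP M.
    by rewrite M0 !big_ord0 big_geq // mulr0 addr0.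
  rewrite -[in RHS](big_mkord xpredT (fun h => p h * e (h%:R * x))) big_ltn //
    ReD.
  congr (_ + _).
    rewrite /p eqxx -(sE 0%N) subn0; congr Re; apply: eq_bigr => i _.
    by rewrite addn0.
  rewrite !Re_sum mulr_sumr; apply: eq_big_nat => h /andP[h0 _].
  rewrite sE /p gtn_eqF // -mulrA [RHS]ReM.
  have -> : Re (2 : R[i]) = 2 by [].
  have -> : Im (2 : R[i]) = 0 by rewrite /= addr0.
  by rewrite mul0r subr0.
apply: le_trans (_ : \int[mu]_(x in I01)
    Re (trigpoly p M x * conjc (trigpoly p M x)) <= _).
  apply: le_Rintegral => //.
  - apply: continuous_integrable01 => x.
    apply: (@continuous_comp _ _ _ (fun x => cabs (trigpoly _ M x)) (fun y =>
      y ^+ 4)).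
      exact: continuous_cabs_trigpoly.
    exact: exprn_continuous.
  - apply: continuous_integrable01; exact: continuous_Re_trigpolyM_conj.
  - move=> x _; rewrite -cabs_sqr (exprM _ 2 2) gE.
    by rewrite -real_normK ?num_real // ler_exprn // normr_Re_le_cabs.
rewrite parseval mulr_sumr; apply: ler_sum => h _.
rewrite -cabs_sqr /p -/(s h); case: ifP => _.
  by rewrite ler_peMl ?sqr_ge0 // ler1n.
have c2 : cabs (2 : R[i]) = 2.
  by rewrite /cabs /= addr0 expr0n addr0 sqrtr_sqr ger0_norm.
by rewrite cabsM c2 exprMn -natrX.
Qed.

End TrigPolynomials.

(** * Sums of reciprocal distances to the integers near a rational *)

Section ReciprocalSums.
Variable R : realType.

Lemma harmonic_le_ln q : (0 < q)%N ->
  \sum_(s < q) s.+1%:R^-1 <= 1 + ln q%:R :> R.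
Proof.
case: q => // q _; elim: q => [|q IH].
  by rewrite big_ord1 invr1 ln1 addr0.
rewrite big_ord_recr /=.
have q2 : q.+2%:R != 0 :> R by rewrite pnatr_eq0.
have xP : -1 < - q.+2%:R^-1 :> R.
  by rewrite ltrN2 invf_lt1 ?ltr0n // ltr1n.
have := le_ln1Dx xP.
have -> : 1 - q.+2%:R^-1 = q.+1%:R / q.+2%:R :> R.
  have -> : q.+1%:R = q.+2%:R - 1 :> R by rewrite -[q.+2%:R]natr1 addrK.
  by rewrite mulrBl divff // mul1r.
rewrite ln_div ?posrE ?ltr0n // => H.
move: IH H; set S := \sum_(_ < _) _; set b := ln _; set c := ln _.
by set x := _^-1; lra.
Qed.

Lemma ln_le_powR (eta x : R) : 0 < eta -> 0 < x -> ln x <= x `^ eta / eta.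
Proof.
move=> eta0 x0; rewrite ler_pdivlMr // mulrC -ln_powR.
have xe : 0 < x `^ eta by exact: powR_gt0.
have := @le_ln1Dx _ (x `^ eta - 1); rewrite ltrBrDr addNr => /(_ xe).
by rewrite addrC subrK => H; lra.
Qed.

Variables (al : R) (a : int) (q : nat).
Hypothesis q0 : (0 < q)%N.
Hypothesis aq : coprimez a q%:Z.
Hypothesis al_aq : `|al - a%:~R / q%:R| <= 1 / q%:R ^+ 2.

(** A bound for [geom_bound] at a point whose distance to the integers is at least [(s - 1) / q];
    the loss of 1 pays for the error of rational approximation. *)
Definition residue_weight (M : R) (s : nat) : R :=
  if (s <= 1)%N then M else q%:R / s.-1%:R.

Lemma residue_weight_ge0 M s : 0 <= M -> 0 <= residue_weight M s.
Proof. by rewrite /residue_weight; case: ifP => // _ _; rewrite divr_ge0. Qed.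

Lemma sum_residue_weight M : 0 <= M ->
  \sum_(s < q) residue_weight M s <= 2 * M + q%:R * (1 + ln q%:R).
Proof.
(* With two extra terms, the first two weights are [M] and the other [q] form a complete harmonic
   sum. *)
move=> M0; apply: le_trans (_ : \sum_(s < q.+2) residue_weight M s <= _).
  by rewrite !big_ord_recr /= -addrA lerDl addr_ge0 ?residue_weight_ge0.
rewrite -(big_mkord xpredT (residue_weight M)) !big_nat_recl //=.
rewrite /residue_weight /= addrA -mulr2n -[M *+ 2]mulr_natl lerD2l.
by rewrite -mulr_sumr big_mkord ler_wpM2l ?ler0n ?harmonic_le_ln.
Qed.

Definition residue (b : int) (r : nat) : nat := `|(r%:Z * a + b) %% q%:Z|%Z%N.

Lemma residueE b r :
  r%:Z * a + b = ((r%:Z * a + b) %/ q%:Z)%Z * q%:Z + (residue b r)%:Z.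
Proof.
rewrite /residue gez0_abs; first exact: divz_eq.
by rewrite modz_ge0 // eqz_nat -lt0n.
Qed.

Lemma residue_lt b r : (residue b r < q)%N.
Proof.
rewrite -ltz_nat /residue gez0_abs ?ltz_pmod ?ltz_nat //.
by rewrite modz_ge0 // eqz_nat -lt0n.
Qed.

Lemma residue_inj b : injective (fun r : 'I_q => Ordinal (residue_lt b r)).
Proof.
move=> r r' /(congr1 val) /= H; apply/val_inj => /=.
have : (q%:Z %| (r%:Z - r'%:Z) * a)%Z.
  have -> : (r%:Z - r'%:Z) * a = (((r%:Z * a + b) %/ q%:Z)%Z -
      ((r'%:Z * a + b) %/ q%:Z)%Z) * q%:Z.
    have := residueE b r; have := residueE b r'; rewrite H.
    set t := (_ %/ _)%Z; set t' := (_ %/ _)%Z; lia.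
  exact: dvdz_mull.
rewrite Gauss_dvdzl 1?coprimez_sym // -eqz_mod_dvd => /eqP.
by rewrite !modz_small ?ltz_nat ?ltn_ord // => -[].
Qed.

(** Multiplied by [q], the argument is [r * a + b] plus a fractional part in [[0, 1)] plus
    [r * q * beta], of absolute value at most 1, where [beta = al - a / q]. Modulo [q] it therefore
    lies in [[s - 1, s + 2)]: at least [s - 1] from the lower end and more than [(q - 1 - s) - 1]
    from the upper one, which explains the two weights. *)
Lemma geom_bound_le_residue (M : R) (n0 r : nat) (b : int) : 0 <=
  M -> (r < q)%N ->
  b = Num.floor (q%:R * (n0%:R * al)) ->
  geom_bound M ((n0 + r)%:R * al) <=
  residue_weight M (residue b r) + residue_weight M (q.-1 - residue b r).
Proof.
move=> M0 rq bE; set s := residue b r.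
have sq : (s < q)%N := residue_lt b r.
have w0 u : 0 <= residue_weight M u by exact: residue_weight_ge0.
case: (leqP s 1) => s1.
  apply: le_trans (geom_bound_le _ _) _.
  by rewrite [X in X + _]/residue_weight s1 lerDl.
case: (leqP (q.-1 - s) 1) => s2.
  apply: le_trans (geom_bound_le _ _) _.
  by rewrite [X in _ + X]/residue_weight s2 lerDr.
have qR : 0 < q%:R :> R by rewrite ltr0n.
have /andP[eta0 eta1] := floor_itv (q%:R * (n0%:R * al)).
rewrite -bE in eta0 eta1; rewrite intrD in eta1.
set t := ((r%:Z * a + b) %/ q%:Z)%Z.
have tE : r%:R * a%:~R + b%:~R = t%:~R * q%:R + s%:R :> R.
  have := congr1 (fun z : int => z%:~R : R) (residueE b r).
  by rewrite !intrD !intrM.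
pose beta := al - a%:~R / q%:R.
have rb : `|r%:R * (q%:R * beta)| <= 1.
  rewrite !normrM !normr_nat;
    apply: le_trans (_ : q%:R * (q%:R * (1 / q%:R ^+ 2)) <= _).
    apply: ler_pM => //; first by rewrite ler_nat ltnW.
    by rewrite ler_wpM2l.
  by rewrite le_eqVlt; apply/orP; left; apply/eqP; field; rewrite gt_eqF.
pose y := q%:R * ((n0 + r)%:R * al) - t%:~R * q%:R.
have yE : y = s%:R + (q%:R * (n0%:R * al) - b%:~R) + r%:R * (q%:R * beta).
  have : q%:R * al = a%:~R + q%:R * beta by rewrite /beta; field;
    rewrite gt_eqF.
  move: tE; rewrite /y natrD; move: (q%:R * beta) => qb tE alE.
  have -> : q%:R * ((n0%:R + r%:R) * al) =
      q%:R * (n0%:R * al) + r%:R * (q%:R * al) by ring.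
  by rewrite alE mulrDr; lra.
move: rb; rewrite ler_norml => /andP[rb1 rb2].
have y1 : s.-1%:R <= y.
  have : s%:R = s.-1%:R + 1 :> R by rewrite natr1 prednK // ltnW.
  lra.
have y2 : (q.-1 - s).-1%:R <= q%:R - y.
  have : q%:R = (q.-1 - s).-1%:R + s%:R + 2 :> R.
    by rewrite -!natrD; congr (_%:R); lia.
  lra.
have s1R : 0 < s.-1%:R :> R by rewrite ltr0n; lia.
have s2R : 0 < (q.-1 - s).-1%:R :> R by rewrite ltr0n; lia.
have dE : dist_int ((n0 + r)%:R * al) = Num.min (y / q%:R) (1 - y / q%:R).
  apply: (@dist_int_eq _ t); first by rewrite /y; field; rewrite gt_eqF.
  by rewrite divr_ge0 ?ltr_pdivrMr ?mul1r /=; lra.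
rewrite /residue_weight leqNgt s1 leqNgt s2 /=.
case: (lerP (y / q%:R) (1 - y / q%:R)) => yy.
  apply: le_trans (_ : q%:R / s.-1%:R <= _); last by rewrite lerDl divr_ge0.
  rewrite -[q%:R / _]invf_div; apply: geom_bound_le_inv;
    first by rewrite divr_gt0.
  by rewrite dE min_l // ler_pM2r ?invr_gt0.
apply: le_trans (_ : q%:R / (q.-1 - s).-1%:R <= _);
  last by rewrite lerDr divr_ge0.
rewrite -[q%:R / _]invf_div; apply: geom_bound_le_inv;
  first by rewrite divr_gt0.
by rewrite dE (min_r (ltW yy)) ler_pdivrMr // mulrBl mul1r divfK ?gt_eqF.
Qed.

(** Over [q] consecutive integers the residues run through a permutation, and [s] to [q - 1 - s] is
    another one, so both weights have the same sum. *)
Lemma sum_geom_bound_block (M : R) (n0 : nat) : 0 <= M ->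
  \sum_(r < q) geom_bound M ((n0 + r)%:R * al) <=
  4 * M + 2 * q%:R * (1 + ln q%:R).
Proof.
move=> M0; pose b := Num.floor (q%:R * (n0%:R * al)).
apply: le_trans (_ : \sum_(r < q) (residue_weight M (residue b r) +
    residue_weight M (q.-1 - residue b r)) <= _).
  by apply: ler_sum => r _; exact: (geom_bound_le_residue (n0 := n0)).
pose G s := residue_weight M s + residue_weight M (q.-1 - s).
have <- : \sum_(s < q) G s = \sum_(r < q) G (residue b r).
  exact: (reindex_inj (@residue_inj b)).
rewrite big_split /=.
have -> : \sum_(s < q) residue_weight M (q.-1 - s) =
    \sum_(s < q) residue_weight M s.
  rewrite [RHS](reindex_inj rev_ord_inj); apply: eq_bigr => s _ /=.
  by congr residue_weight; have := ltn_ord s; lia.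
have := sum_residue_weight M0; lra.
Qed.

Lemma sum_geom_bound (M : R) (Y : nat) : 0 <= M ->
  \sum_(1 <= n < Y.+1) geom_bound M (n%:R * al) <=
  (Y%:R / q%:R + 1) * (4 * M + 2 * q%:R * (1 + ln q%:R)).
Proof.
move=> M0; pose B := 4 * M + 2 * q%:R * (1 + ln q%:R).
have g0 n : 0 <= geom_bound M (n%:R * al) by exact: geom_bound_ge0.
have blocks K : \sum_(n < K * q) geom_bound M (n%:R * al) <= K%:R * B.
  elim: K => [|K IH]; first by rewrite mul0n big_ord0 mul0r.
  rewrite mulSnr big_split_ord /= -[K.+1%:R]natr1 mulrDl mul1r lerD //.
  exact: sum_geom_bound_block.
have B0 : 0 <= B.
  by rewrite addr_ge0 ?mulr_ge0 ?addr_ge0 ?ln_ge0 ?ler1n.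
(* The range is completed to whole blocks by adding [n = 0] and the rest of the last block. *)
apply: le_trans (_ : \sum_(n < (Y %/ q).+1 * q) geom_bound M (n%:R * al) <= _).
  rewrite -(big_mkord xpredT (fun n => geom_bound M (n%:R * al))).
  have Yq : (Y.+1 <= (Y %/ q).+1 * q)%N by exact: ltn_ceil.
  rewrite (big_cat_nat _ Yq) //=.
  by rewrite [X in X + _]big_ltn // -addrA addrCA lerDl addr_ge0 ?sumr_ge0.
apply: le_trans (blocks _) _; rewrite -/B ler_wpM2r // -natr1 lerD2r.
by rewrite ler_pdivlMr ?ltr0n // -natrM ler_nat leq_divM.
Qed.

End ReciprocalSums.

(** * Duality between the exponents 4/3 and 4 *)

Section Duality.
Variable R : realType.
Local Notation mu := (@lebesgue_measure R).
Local Notation I01 := (`[0%R, 1%R]%classic : set R).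

(** Young's inequality up to a constant: with [s = c ^+ 3], the product [c ^+ 3 * t] is at most the
    fourth power of the larger of [c] and [t]. *)
Lemma mul_le_powR_exp4 (s t : R) : 0 <= s -> 0 <= t ->
  s * t <= s `^ (4 / 3) + t ^+ 4.
Proof.
move=> s0 t0; pose c := s `^ 3^-1.
have c0 : 0 <= c by exact: powR_ge0.
have -> : s `^ (4 / 3) = c ^+ 4 by rewrite -powR_mulrn // -powRrM mulrC.
have -> : s = c ^+ 3 by rewrite -powR_mulrn // -powRrM mulVf ?powRr1.
have [tc|ct] := lerP t c.
  apply: le_trans (_ : c ^+ 4 <= _); last by rewrite lerDl exprn_ge0.
  by rewrite [leRHS]exprSr ler_wpM2l ?exprn_ge0.
apply: le_trans (_ : t ^+ 4 <= _); last by rewrite lerDr exprn_ge0.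
by rewrite [leRHS]exprSr ler_wpM2r // ler_exprn // ltW.
Qed.

Lemma cabs_rotate (z : R[i]) : exists2 w : R[i], cabs w = 1 & Re (w * z)
  = cabs z.
Proof.
have [z0|z0] := eqVneq (cabs z) 0.
  exists 1; first exact: ComplexField.Normc.normc1.
  by rewrite z0 (ComplexField.Normc.eq0_normc z0) mulr0.
exists (conjc z * ((cabs z)^-1)%:C%C).
  rewrite cabsM cabsJ /cabs /= expr0n addr0 sqrtr_sqr -/(cabs z).
  by rewrite ger0_norm ?invr_ge0 ?cabs_ge0 // divff.
rewrite mulrAC ReM /= mulr0 subr0 mulrC [_ * z]mulrC -cabs_sqr expr2.
by rewrite mulKf.
Qed.

(* Weights [X] and [Y] are the target values of the two norms in Hölder's
   inequality with exponents 4/3 and 4. *)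
Lemma cabs_pairing_le (f : nat -> R) (v : nat -> R[i]) M (p X Y : R) :
  0 < X -> 0 < Y -> 1 <= p <= 4 / 3 ->
  (\sum_(n < M) cabs (v n)) `^ (4 / 3 - p) *
    \int[mu]_(x in I01) cabs (trigpoly v M x) `^ p <= X `^ (4 / 3) ->
  \int[mu]_(x in I01) cabs (trigpoly (fun i => e (f i)) M x) ^+ 4 <= Y ^+ 4 ->
  cabs (\sum_(n < M) e (f n) * conjc (v n)) <= 2 * (X * Y).
Proof.
move=> X0 Y0 /andP[p1 p43] HX HY.
set S := \sum_(n < M) cabs (v n) in HX.
set I := Rintegral _ _ _ in HX; set J := Rintegral _ _ _ in HY.
set F := \sum_(n < M) _; have [w w1 wF] := cabs_rotate F.
pose u n := w * e (f n).
have uE x : trigpoly u M x = w * trigpoly (fun i => e (f i)) M x.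
  by rewrite /trigpoly mulr_sumr; apply: eq_bigr => n _; rewrite /u mulrA.
have S0 : 0 <= S by apply: sumr_ge0 => n _; exact: cabs_ge0.
have XY0 : 0 <= X * Y by rewrite mulr_ge0 // ltW.
(* Hölder is derived from the pointwise inequality applied to [K / X] and [g / Y]. The weights [a]
   and [b] are scaled so that each of the two integrals contributes at most [X * Y]. *)
pose a := X * Y * (S `^ (4 / 3 - p) / X `^ (4 / 3)).
pose b := X * Y / Y ^+ 4.
have p0 : 0 <= p by apply: le_trans p1.
have iK := @integrable_cabs_trigpoly_powR R v M p p0.
have cg : continuous (fun x : R => cabs (trigpoly (fun i => e (f i)) M x) ^+ 4).
  move=> x; apply: (@continuous_comp _ _ _ (fun x => cabs (trigpoly _ M x))
    (fun y => y ^+ 4)); first exact: continuous_cabs_trigpoly.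
  exact: exprn_continuous.
have ig := continuous_integrable01 cg.
have -> : cabs F = \int[mu]_(x in I01)
  Re (trigpoly u M x * conjc (trigpoly v M x)).
  rewrite parseval -Re_sum -wF; congr Re; rewrite mulr_sumr.
  by apply: eq_bigr => n _; rewrite /u mulrA.
have aI : a * I <= X * Y.
  rewrite /a -mulrA -[leRHS]mulr1 ler_wpM2l //.
  by rewrite mulrAC ler_pdivrMr ?powR_gt0 // mul1r.
have bJ : b * J <= X * Y.
  rewrite /b -mulrA -[leRHS]mulr1 ler_wpM2l //.
  by rewrite mulrC ler_pdivrMr ?exprn_gt0 // mul1r.
pose Kp (x : R) := cabs (trigpoly v M x) `^ p.
pose g4 (x : R) := cabs (trigpoly (fun i => e (f i)) M x) ^+ 4.
have iaK : mu.-integrable I01 (EFin \o (fun x => a * Kp x)).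
  rewrite (_ : EFin \o _ = (fun x : R => a%:E * (Kp x)%:E)%E) //.
  exact: integrableZl.
have ibg : mu.-integrable I01 (EFin \o (fun x => b * g4 x)).
  by apply: continuous_integrable01 => x; apply: cvgMr; exact: cg.
apply: le_trans (_ : \int[mu]_(x in I01) (a * Kp x + b * g4 x) <= _).
  apply: le_Rintegral => //.
  - by apply: continuous_integrable01; exact: continuous_Re_trigpolyM_conj.
  - rewrite (_ : EFin \o _ =
      (fun x : R => (a * Kp x)%R%:E + (b * g4 x)%R%:E)%E) //.
    exact: integrableD.
  move=> x _; apply: le_trans (Re_le_cabs _) _.
  rewrite cabsM cabsJ uE cabsM w1 mul1r /Kp /g4.
  set g := cabs (trigpoly (fun i => _) _ _); set K := cabs _.
  have g0 : 0 <= g by exact: cabs_ge0.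
  have K0 : 0 <= K by exact: cabs_ge0.
  have KS : K <= S by exact: cabs_trigpoly_le.
  have -> : g * K = X * Y * ((K / X) * (g / Y)).
    by field; rewrite !gt_eqF.
  apply: le_trans (_ : X * Y * ((K / X) `^ (4 / 3) + (g / Y) ^+ 4) <= _).
    by apply: ler_wpM2l => //; apply: mul_le_powR_exp4; rewrite divr_ge0 // ltW.
  rewrite mulrDr lerD //; last first.
    by rewrite le_eqVlt /b; apply/orP; left; apply/eqP; field; rewrite gt_eqF.
  rewrite /a -[X * Y * _ * _]mulrA; apply: ler_wpM2l => //.
  rewrite powRM ?invr_ge0 ?(ltW X0) // mulrAC.
  have -> : X^-1 `^ (4 / 3) = (X `^ (4 / 3))^-1.
    by rewrite -powR_inv1 ?(ltW X0) // -powRrM mulN1r powRN.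
  rewrite ler_wpM2r ?invr_ge0 ?powR_ge0 //.
  have [->|Kn0] := eqVneq K 0.
    by rewrite powR0 ?mulr_ge0 ?powR_ge0 // mulf_neq0 ?invr_eq0 ?pnatr_eq0.
  (* Here [p <= 4/3] enters: the surplus power of [K] is bounded by the same power of [S]. *)
  rewrite -[4 / 3 in leLHS](subrK p) powRD ?Kn0 ?implybT //.
  by rewrite ler_wpM2r ?powR_ge0 // ge0_ler_powR ?nnegrE // subr_ge0.
rewrite RintegralD // !RintegralZl // -/I -/J; lra.
Qed.

End Duality.

(** * The moment of the differenced Weyl sums *)

Section WeylMoment.
Variable R : realType.

Lemma divisor_powR_bound (delta : R) : 0 < delta ->
  exists2 C : R, 1 <= C &
    forall m, (0 < m)%N -> (size (divisors m))%:R <= C * m%:R `^ delta.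
Proof.
move=> d0; pose r := (Num.truncn delta^-1).+1.
have r0 : 0 < r%:R :> R by rewrite ltr0n.
have rd : r%:R^-1 <= delta.
  by rewrite invf_ple ?posrE // ltW // truncnS_gt.
pose K := ((r ^ r) ^ (2 ^ r))%N.
have K1 : (0 < K)%N by rewrite !expn_gt0.
exists (K%:R `^ r%:R^-1).
  by rewrite -[leLHS](powRr0 K%:R) ler_powR ?ler1n // invr_ge0 ltW.
move=> m m0; apply: le_trans (_ : K%:R `^ r%:R^-1 * m%:R `^ r%:R^-1 <= _).
  rewrite -powRM // -natrM.
  have -> : (size (divisors m))%:R = (size (divisors m) ^ r)%:R `^ r%:R^-1 :> R.
    by rewrite natrX -powR_mulrn // -powRrM divff ?powRr1 ?gt_eqF.
  by rewrite ge0_ler_powR ?nnegrE ?invr_ge0 ?ler_nat ?divisor_bound // ltW.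
by rewrite ler_wpM2l ?powR_ge0 // ler_powR ?ler1n.
Qed.

Lemma powR_ge1 (x y : R) : 1 <= x -> 0 <= y -> 1 <= x `^ y.
Proof. by move=> x1 y0; rewrite -[leLHS](powRr0 x) ler_powR. Qed.

Lemma weyl_sum_powR_bound (n : nat) (eta : R) : 0 < eta ->
  exists2 C : R, 0 < C &
  forall (f : nat -> R) (al : R) (a : int) (q M : nat),
    (0 < q)%N -> coprimez a q%:Z -> `|al - a%:~R / q%:R| <= 1 / q%:R ^+ 2 ->
    polydiff n.+3 al f -> (0 < M)%N -> (q <= M ^ n.+3)%N ->
    weyl_sum M n.+2 f M <=
    C * (M%:R `^ eta *
         (M%:R ^+ n.+3 * (q%:R^-1 + M%:R^-1 + q%:R * M%:R ^- n.+3))).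
Proof.
move=> eta0; pose k2 : R := n.+2%:R.
have k20 : 0 < k2 by rewrite ltr0n.
(* The divisor bound is used [k2] times at integers up to a constant times [M ^ k2], so its total
   cost is [M ^ (eta / 2)]; the other half of [eta] is reserved for [ln q]. *)
pose delta := eta / 2 / k2 / k2.
have delta0 : 0 < delta by rewrite !divr_gt0.
have [Cd Cd1 HCd] := divisor_powR_bound delta0.
have Cd0 : 0 < Cd by apply: lt_le_trans Cd1.
pose X := (n.+3)`!; have X0 : (0 < X)%N by exact: fact_gt0.
(* From [q <= M ^ n.+3] one gets [ln q <= n.+3 * ln M], and [ln M] is at most [2 / eta] times
   [M ^ (eta / 2)]. *)
pose CL := 1 + n.+3%:R * (2 / eta).
have CL0 : 0 < CL by rewrite addr_gt0 // mulr_gt0 ?ltr0n // divr_gt0.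
pose CD := Cd ^+ n.+2 * X%:R `^ (delta * k2).
have CD0 : 0 < CD by rewrite mulr_gt0 ?exprn_gt0 // powR_gt0 // ltr0n.
exists (CD * CL * (n + 14)%:R * X%:R).
  have n14 : 0 < (n + 14)%:R :> R by rewrite ltr0n addn_gt0 orbT.
  have XR0 : 0 < X%:R :> R by rewrite ltr0n.
  by do 2![apply: mulr_gt0 => //]; exact: mulr_gt0.
move=> f al a q M q0 aq alq Hf M0 qM.
have MR1 : 1 <= M%:R :> R by rewrite ler1n.
have MR0 : 0 < M%:R :> R by rewrite ltr0n.
have qR0 : 0 < q%:R :> R by rewrite ltr0n.
pose Y := (X * M ^ n.+2)%N.
have Y0 : (0 < Y)%N by rewrite muln_gt0 X0 expn_gt0 M0.
pose F m := geom_bound M%:R (m%:R * al).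
have F0 m : 0 <= F m by apply: geom_bound_ge0; rewrite ltW.
have FM : F 0%N <= M%:R by exact: geom_bound_le.
pose D := Cd * Y%:R `^ delta.
have D1 : 1 <= D.
  by rewrite -[1]mulr1 ler_pM // powR_ge1 ?ler1n // ltW.
have HD m : (0 < m <= X * M ^ n.+2)%N -> (size (divisors m))%:R <= D.
  move=> /andP[m0 mY]; apply: le_trans (HCd m m0) _.
  rewrite ler_wpM2l ?(ltW Cd0) // ge0_ler_powR ?nnegrE ?(ltW delta0) //.
  by rewrite ler_nat.
have W1 : weyl_sum M n.+2 f M <= prodsum F M n.+2 X.
  rewrite -[X]muln1; apply: (weyl_sum_le_prodsum (al := al)) => //.
    by move=> m g L LM Hg; exact: expsum_linear_le.
  by rewrite mul1r.
have W2 := sum_prodsum_le F0 FM M0 D1 HD.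
have W3 := sum_geom_bound q0 aq alq Y (ltW MR0).
pose Lg : R := 1 + ln q%:R.
have Lg1 : 1 <= Lg by rewrite lerDl ln_ge0 // ler1n.
have LgM : Lg <= CL * M%:R `^ (eta / 2).
  have e20 : 0 < eta / 2 by rewrite divr_gt0.
  have M1 : 1 <= M%:R `^ (eta / 2) by rewrite powR_ge1 // ltW.
  rewrite /CL mulrDl mul1r lerD //.
  apply: le_trans (_ : ln (M%:R ^+ n.+3) <= _).
    by rewrite ler_ln ?posrE ?exprn_gt0 // -natrX ler_nat.
  rewrite lnXn // -(mulr_natl (ln _)) -mulrA ler_wpM2l //.
  by have := ln_le_powR e20 MR0; rewrite [_ / (eta / 2)]mulrC invf_div.
have DM : D ^+ n.+2 = CD * M%:R `^ (eta / 2).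
  have YE' : (Y%:R `^ delta) ^+ n.+2 = Y%:R `^ (delta * k2).
    by rewrite -powR_mulrn ?powR_ge0 // -powRrM.
  rewrite /D exprMn YE' /CD -mulrA; congr (_ * _).
  rewrite /Y natrM powRM // natrX; congr (_ * _).
  rewrite -powR_mulrn ?(ltW MR0) // -powRrM -/k2.
  by congr (_ `^ _); rewrite /delta; field; rewrite gt_eqF.
set V := q%:R^-1 + _ + _.
pose T1 : R := M%:R ^+ n.+3 / q%:R; pose T2 : R := M%:R ^+ n.+2.
have PV : M%:R ^+ n.+3 * V = T1 + T2 + q%:R.
  rewrite /V !mulrDr /T1 /T2; congr (_ + _ + _).
    by rewrite exprSr mulfK // gt_eqF.
  by rewrite mulrCA divff ?mulr1 // expf_neq0 // gt_eqF.
have T10 : 0 <= T1 by rewrite divr_ge0 ?exprn_ge0 // ltW.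
have T2M : M%:R <= T2 by rewrite /T2 exprSr ler_peMl ?exprn_ege1 // ltW.
have XR1 : 1 <= X%:R :> R by rewrite ler1n.
have YE : Y%:R = X%:R * T2 by rewrite natrM natrX.
have YqE : Y%:R / q%:R * M%:R = X%:R * T1.
  by rewrite YE /T1 /T2 [in RHS]exprSr; ring.
have SF : \sum_(1 <= m < (X * M ^ n.+2).+1) F m + (n.+2 * X * M ^ n.+2)%:R <=
    Lg * ((n + 14)%:R * X%:R * (T1 + T2 + q%:R)).
  have -> : (n.+2 * X * M ^ n.+2)%:R = n.+2%:R * (X%:R * T2).
    by rewrite -mulnA natrM -/Y YE.
  (* The zero shifts account for [n + 2]; 12 is the sum of the coefficients 4, 2, 4, 2 of the
     expanded product below. *)
  rewrite (_ : n + 14 = n.+2 + 12)%N; last by rewrite addSnnS addSnnS.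
  rewrite natrD.
  apply: le_trans (lerD W3 (lexx _)) _; rewrite -/Lg.
  apply: le_trans (_ : Lg * ((Y%:R / q%:R + 1) * (4 * M%:R + 2 * q%:R)) +
      Lg * (n.+2%:R * (X%:R * T2)) <= _).
    apply: lerD; last by rewrite ler_peMl // mulr_ge0 //
      mulr_ge0 ?exprn_ge0 // ltW.
    rewrite [leRHS]mulrCA ler_wpM2l ?addr_ge0 ?divr_ge0 //.
    rewrite [leRHS]mulrDr lerD //; last by rewrite le_eqVlt; apply/orP; left;
      apply/eqP; ring.
    by rewrite ler_peMl // mulr_ge0 // ltW.
  rewrite -mulrDr ler_wpM2l ?(le_trans _ Lg1) //.
  have -> : (Y%:R / q%:R + 1) * (4 * M%:R + 2 * q%:R) =
      4 * (X%:R * T1) + 2 * (X%:R * T2) + 4 * M%:R + 2 * q%:R.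
    by rewrite -YqE -YE; field; rewrite gt_eqF.
  have XT2 : T2 <= X%:R * T2 by rewrite ler_peMl // (le_trans _ T2M) // ltW.
  have Xq : q%:R <= X%:R * q%:R :> R by rewrite ler_peMl // ltW.
  have XT1 : 0 <= X%:R * T1 by rewrite mulr_ge0.
  have n1 : 0 <= n.+2%:R * (X%:R * T1) by rewrite mulr_ge0.
  have n2 : 0 <= n.+2%:R * (X%:R * q%:R) :> R by rewrite !mulr_ge0.
  rewrite -[_ * X%:R * _]mulrA [X%:R * (_ + _)]mulrDr [X%:R * (T1 + _)]mulrDr.
  move: XT2 Xq XT1 n1 n2; set A := X%:R * T1; set B := X%:R * T2.
  set E' := X%:R * q%:R; set nn : R := n.+2%:R => *.
  by lra.
(* Only the term [c = X] is wanted; as [X] is a constant, positivity allows the whole sum over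
   [c]. *)
apply: le_trans W1 _;
  apply: le_trans (_ : \sum_(1 <= c < X.+1) prodsum F M n.+2 c <= _).
  rewrite big_nat_recr // lerDr sumr_ge0 // => c _.
  exact: (prodsum_ge0 M F0 n.+2 c).
apply: le_trans W2 _; rewrite PV.
apply: le_trans (ler_wpM2l (exprn_ge0 _ (le_trans ler01 D1)) SF) _.
rewrite DM.
have B0 : 0 <= (n + 14)%:R * X%:R * (T1 + T2 + q%:R) :> R.
  by rewrite !mulr_ge0 // !addr_ge0 // ltW // exprn_gt0.
have eE : M%:R `^ eta = M%:R `^ (eta / 2) * M%:R `^ (eta / 2) :> R.
  rewrite -powRD; first by congr (_ `^ _); lra.
  by rewrite (gt_eqF MR0) implybT.
have Me0 : 0 <= CD * M%:R `^ (eta / 2) by rewrite mulr_ge0 ?powR_ge0 // ltW.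
apply: le_trans (ler_wpM2l Me0 (ler_wpM2r B0 LgM)) _.
by rewrite eE le_eqVlt; apply/orP; left; apply/eqP; ring.
Qed.

(** The power mean turns each square into the power [2 ^ n.+1], which is what [n + 1] differencings
    control, and the sum over [h] becomes the outermost shift of a [weyl_sum] of depth [n + 2]. The
    powers of [M] collected on the way add up to [3 * 2 ^ n]. *)
Lemma weyl_moment_bound (n : nat) (eta : R) : 0 < eta ->
  exists2 C : R, 0 < C &
  forall (f : nat -> R) (al : R) (a : int) (q M : nat),
    (0 < q)%N -> coprimez a q%:Z -> `|al - a%:~R / q%:R| <= 1 / q%:R ^+ 2 ->
    polydiff n.+3 al f -> (0 < M)%N -> (q <= M ^ n.+3)%N ->
    (\sum_(h < M) cabs (expsum (fdiff h f) (M - h)) ^+ 2) ^+ (2 ^ n) <=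
    C * (M%:R `^ eta * M%:R ^+ (3 * 2 ^ n) *
         (q%:R^-1 + M%:R^-1 + q%:R * M%:R ^- n.+3)).
Proof.
move=> eta0; have [C C0 HC] := weyl_sum_powR_bound n eta0.
exists (2 ^+ (2 ^ n.+1).-1 * C); first by rewrite mulr_gt0 ?exprn_gt0.
move=> f al a q M q0 aq alq Hf M0 qM.
have {}HC := HC f al a q M q0 aq alq Hf M0 qM.
pose b h := cabs (expsum (fdiff h f) (M - h)) ^+ 2.
have b0 h : 0 <= b h by exact: sqr_ge0.
apply: le_trans (exp_sum_le n M b0) _.
apply: le_trans (_ : M%:R ^+ (2 ^ n).-1 * (2 ^+ (2 ^ n.+1).-1 *
    M%:R ^+ (2 ^ n.+1 - n.+2) * weyl_sum M n.+2 f M) <= _).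
  rewrite ler_wpM2l ?exprn_ge0 // [weyl_sum M n.+2 f M]/= mulr_sumr.
  apply: ler_sum => h _; rewrite /b -exprM -expnS.
  exact: (weyl_differencing n.+1 (fdiff h f) (leq_subr h M)).
have K0 : 0 <= M%:R ^+ (2 ^ n).-1 * (2 ^+ (2 ^ n.+1).-1 *
    M%:R ^+ (2 ^ n.+1 - n.+2)) :> R by rewrite !mulr_ge0 ?exprn_ge0.
rewrite mulrA; apply: le_trans (ler_wpM2l K0 HC) _.
have -> : (3 * 2 ^ n = (2 ^ n).-1 + (2 ^ n.+1 - n.+2) + n.+3)%N.
  have := ltn_expl n.+1 (isT : (1 < 2)%N);
    have : (0 < 2 ^ n)%N by rewrite expn_gt0.
  rewrite !expnS; lia.
by rewrite !exprD le_eqVlt; apply/orP; left; apply/eqP; ring.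
Qed.

End WeylMoment.

(** * Sums over the set as trigonometric polynomials, and the conclusion *)

Section SumsOverA.
Variable R : realType.
Implicit Types (A : set nat) (N : R).

Lemma upto_subset A N : 0 <= N -> upto A N `<=` `I_(Num.truncn N).+1.
Proof. by move=> N0 n [_ /andP[_ nN]] /=; rewrite ltnS truncn_ge_nat. Qed.

Lemma finite_upto A N : 0 <= N -> finite_set (upto A N).
Proof. by move=> N0; apply: sub_finite_set (upto_subset N0) (finite_II _). Qed.

Lemma sum_upto (T : zmodType) A N (F : nat -> T) : 0 <= N ->
  \sum_(n \in upto A N) F n =
  \sum_(n < (Num.truncn N).+1) (if (n : nat) \in upto A N then F n else 0).
Proof.
move=> N0; rewrite -[in LHS](setIidr (upto_subset N0)) fsbig_mkcondr.
by rewrite -(fsbig_ord _ _ (fun n => if n \in upto A N then F n else 0)).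
Qed.

Definition upto_indic A N (n : nat) : R[i] := if n \in upto A N then 1 else 0.

Lemma sum_upto_e A N (f : nat -> R) : 0 <= N ->
  \sum_(n \in upto A N) e (f n) =
  \sum_(n < (Num.truncn N).+1) e (f n) * conjc (upto_indic A N n).
Proof.
move=> N0; rewrite sum_upto //; apply: eq_bigr => n _; rewrite /upto_indic.
by case: ifP => _; rewrite ?conjc1 ?conjc0 ?mulr1 ?mulr0.
Qed.

Lemma sum_upto_trigpoly A N (x : R) : 0 <= N ->
  \sum_(n \in upto A N) e (n%:R * x) =
  trigpoly (upto_indic A N) (Num.truncn N).+1 x.
Proof.
move=> N0; rewrite sum_upto //; apply: eq_bigr => n _; rewrite /upto_indic.
by case: ifP => _; rewrite ?mul1r ?mul0r.
Qed.

Lemma counting_fun_indic A N : 0 <= N ->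
  (counting_fun A N)%:R =
  \sum_(n < (Num.truncn N).+1) cabs (upto_indic A N n) :> R.
Proof.
move=> N0; transitivity (\sum_(n \in upto A N) (1 : R)).
  rewrite fsbig_finite; last exact: finite_upto.
  by rewrite /counting_fun card_fset_sum1 natr_sum.
rewrite sum_upto //; apply: eq_bigr => n _; rewrite /upto_indic.
by case: ifP => _; rewrite ?cabs0 ?[cabs 1]ComplexField.Normc.normc1.
Qed.

Lemma counting_fun_le A N : 0 <= N -> (counting_fun A N)%:R <= N.
Proof.
move=> N0; rewrite counting_fun_indic // big_ord_recl.
(* There are [truncn N + 1] indices; dropping [n = 0] brings the count down to [truncn N <= N]. *)
have -> : cabs (upto_indic A N (ord0 : 'I_(Num.truncn N).+1)) = 0.
  rewrite /upto_indic; case: ifP => [|_]; last exact: cabs0.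
  by move=> /set_mem[_ /andP[]]; rewrite ler10.
rewrite add0r; apply: le_trans (_ : (Num.truncn N)%:R <= _); last first.
  by rewrite truncn_le.
rewrite -[X in _ <= X%:R]card_ord -sumr_const; apply: ler_sum => n _.
rewrite /upto_indic; case: ifP => _; rewrite ?cabs0 ?ler01 //.
by rewrite [cabs 1]ComplexField.Normc.normc1.
Qed.

End SumsOverA.

Lemma dyadic_exponent (R : realType) (n : nat) :
  2 ^ (1 - (n.+3)%:Z) = (2 ^+ n)^-1 / 4 :> R.
Proof.
have -> : 1 - (n.+3)%:Z = - (n.+2)%:Z by lia.
by rewrite -exprnN !exprS; field; rewrite expf_neq0.
Qed.

(** The root of order [2 ^ n] is taken, and [N <= M <= 2 * N] replaces the integer length by [N]:
    negative powers of [M] only improve, positive ones cost powers of 2. *)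
Lemma fourth_moment_poly_le (R : realType) (n : nat) (eta : R) : 0 < eta ->
  exists2 C : R, 0 < C &
  forall (f : nat -> R) (al : R) (a : int) (q : nat) (N : R),
    (0 < q)%N -> coprimez a q%:Z -> `|al - a%:~R / q%:R| <= 1 / q%:R ^+ 2 ->
    polydiff n.+3 al f -> 1 <= N -> (q <= (Num.truncn N).+1 ^ n.+3)%N ->
    \int[lebesgue_measure]_(x in `[0, 1])
      cabs (trigpoly (fun i => e (f i)) (Num.truncn N).+1 x) ^+ 4 <=
    C * (N `^ eta * N ^+ 3 *
      (q%:R^-1 + N^-1 + q%:R * N ^- n.+3) `^ (2 ^+ n)^-1).
Proof.
move=> eta0; have [C C0 HC] := weyl_moment_bound n eta0.
pose d : R := (2 ^+ n)^-1.
have d0 : 0 < d by rewrite invr_gt0 exprn_gt0.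
have dE : (2 ^ n)%:R * d = 1 by rewrite natrX /d divff //
  expf_eq0 pnatr_eq0 andbF.
have d1 : d <= 1 by rewrite invf_le1 ?exprn_gt0 // exprn_ege1 // ler1n.
exists (4 * (C `^ d * (2 `^ (eta * d) * 8))).
  by rewrite !mulr_gt0 ?powR_gt0.
move=> f al a q N q0 aq alq Hf N1; set M := (Num.truncn N).+1 => qM.
have N0 : 0 < N by apply: lt_le_trans N1.
have NM : N <= M%:R by rewrite ltW // truncnS_gt.
have M0 : 0 < M%:R :> R by rewrite ltr0n.
have M2 : M%:R <= 2 * N.
  rewrite /M -natr1; have := truncn_le N; rewrite (ltW N0) => H; lra.
have {}HC := HC f al a q M q0 aq alq Hf isT qM.
apply: le_trans (fourth_moment_le f M) _; rewrite -mulrA ler_pM2l //.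
set G := \sum_(h < M) _ in HC *.
set V := _ + q%:R * N ^- _.
have V0 : 0 <= V by rewrite !addr_ge0 ?mulr_ge0 ?invr_ge0 ?exprn_ge0 // ltW.
have G0 : 0 <= G by apply: sumr_ge0 => h _; exact: sqr_ge0.
have N20 : 0 <= 2 * N by rewrite mulr_ge0 // ltW.
have GE : G = (G ^+ (2 ^ n)) `^ d.
  by rewrite -powR_mulrn // -powRrM dE powRr1.
have B1 : G ^+ (2 ^ n) <= C * ((2 * N) `^ eta * (2 * N) ^+ (3 * 2 ^ n) * V).
  apply: le_trans HC _; rewrite ler_wpM2l ?(ltW C0) //.
  apply: ler_pM.
  - by rewrite mulr_ge0 ?powR_ge0 ?exprn_ge0.
  - by rewrite !addr_ge0 ?mulr_ge0 ?invr_ge0 ?exprn_ge0.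
  - apply: ler_pM; rewrite ?powR_ge0 ?exprn_ge0 //.
      by rewrite ge0_ler_powR ?nnegrE // ltW.
    by rewrite ler_exprn.
  - rewrite /V lerD //; first by rewrite lerD // lef_pV2.
    by rewrite ler_wpM2l // lef_pV2 ?posrE ?exprn_gt0 // ler_exprn // ltW.
rewrite GE; apply: le_trans (_ :
    (C * ((2 * N) `^ eta * (2 * N) ^+ (3 * 2 ^ n) * V)) `^ d <= _).
  rewrite ge0_ler_powR ?nnegrE ?exprn_ge0 // ?(ltW d0) //.
  by apply: le_trans B1; rewrite exprn_ge0.
have E3 : ((2 * N) ^+ (3 * 2 ^ n)) `^ d = 8 * N ^+ 3.
  rewrite exprM -powR_mulrn ?exprn_ge0 // -powRrM dE.
  by rewrite powRr1 ?exprn_ge0 // exprMn; congr (_ * _); ring.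
have E1 : ((2 * N) `^ eta) `^ d <= 2 `^ (eta * d) * N `^ eta.
  rewrite -powRrM powRM // ?(ltW N0) // ler_wpM2l ?powR_ge0 // ler_powR //.
  by rewrite ler_piMr // ltW.
have a10 : 0 <= (2 * N) `^ eta by exact: powR_ge0.
have a20 : 0 <= (2 * N) ^+ (3 * 2 ^ n) by exact: exprn_ge0.
rewrite (powRM _ (ltW C0)) ?mulr_ge0 // (powRM _ (mulr_ge0 a10 a20) V0).
rewrite (powRM _ a10 a20) E3.
have W0 : 0 <= 8 * N ^+ 3 by rewrite mulr_ge0 ?exprn_ge0 ?(ltW N0).
apply: le_trans (ler_wpM2l (powR_ge0 C d)
  (ler_wpM2r (powR_ge0 V d) (ler_wpM2r W0 E1))) _.
by rewrite le_eqVlt; apply/orP; left; apply/eqP; ring.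
Qed.

Theorem theorem1p2 (R : realType) (A : set nat) (p : R) (k : nat)
    (hA : weakly_subconvex A p) (hp : 1 <= p <= 4 / 3) (hk : (3 <= k)%N)
    (eps : R) (heps : 0 < eps) :
  exists C N0 : R,
  forall (alpha : 'I_k.+1 -> R) (a : int) (q : nat),
    (0 < q)%N -> coprimez a q%:Z ->
    `|alpha ord_max - a%:~R / q%:R| <= 1 / q%:R ^+ 2 ->
  forall N : R, N0 <= N ->
    cabs (\sum_(n \in upto A N) e (real_poly alpha n%:R)) <=
      C * (N `^ (1 + eps) *
           (q%:R^-1 + N^-1 + q%:R * N ^- k) `^ (2 ^ (1 - k%:Z))).
Proof.
case: k hk => [|[|[|n]]] // _.
have [_ _ _ HI] := hA; have [C1 [N1 {}HI]] := HI eps heps.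
have [C2 C20 HJ] := fourth_moment_poly_le n heps.
(* The constant of the hypothesis may fail to be positive, while the target [X] below has to be. *)
pose c1 := Num.max C1 1.
have c10 : 0 < c1 by rewrite lt_max ltr01 orbT.
pose c := c1 `^ (3 / 4) * C2 `^ (1 / 4).
have c0 : 0 < c by rewrite mulr_gt0 ?powR_gt0.
exists (1 + 2 * c), (Num.max 1 N1) => alpha a q q0 aq alq N.
rewrite ge_max => /andP[N1' NN1].
have N0 : 0 < N by apply: lt_le_trans N1'.
have Nge0 := ltW N0.
set M := (Num.truncn N).+1; pose v := upto_indic A N.
set V := _ + q%:R * N ^- _.
have qR0 : 0 < q%:R :> R by rewrite ltr0n.
have V0 : 0 < V.
  by rewrite !addr_gt0 ?mulr_gt0 ?invr_gt0 ?exprn_gt0.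
rewrite dyadic_exponent; set d : R := (2 ^+ n)^-1.
have d0 : 0 < d by rewrite invr_gt0 exprn_gt0.
have B0 : 0 <= N `^ (1 + eps) * V `^ (d / 4) by rewrite mulr_ge0 ?powR_ge0.
rewrite sum_upto_e // -/M -/v.
have SN : \sum_(n < M) cabs (v n) <= N.
  by rewrite /M /v -counting_fun_indic // counting_fun_le.
(* For large [q] the last term of [V] is already at least 1, and the trivial bound [N] is enough; it
   accounts for the 1 in [1 + 2 * c]. *)
have [qM|Mq] := leqP q (M ^ n.+3); last first.
  have Vge1 : 1 <= V.
    apply: le_trans (_ : q%:R * N ^- n.+3 <= _); last first.
      by rewrite lerDr addr_ge0 ?invr_ge0 // ltW.
    rewrite ler_pdivlMr ?exprn_gt0 // mul1r.
    apply: le_trans (_ : M%:R ^+ n.+3 <= _);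
      last by rewrite -natrX ler_nat ltnW.
    by apply: ler_exprn => //; rewrite ltW // truncnS_gt.
  apply: le_trans (cabs_sum _ _ _) _.
  under eq_bigr do rewrite cabsM cabs_e mul1r cabsJ.
  apply: le_trans SN _;
    apply: le_trans (_ : N `^ (1 + eps) * V `^ (d / 4) <= _).
    rewrite -[leLHS]mulr1 ler_pM // ?powR_ge1 // ?divr_ge0 ?(ltW d0) //.
    by rewrite -[leLHS]powRr1 // ler_powR // lerDl ltW.
  by rewrite ler_peMl // lerDl mulr_ge0 // ltW.
(* The hypothesis supplies [N ^ (eps - 1)] and [S ^ p]; with the surplus [S ^ (4/3 - p)] this makes
   [S ^ (4/3)], at most [N ^ (4/3)]. So [X] does not depend on [p]. *)
pose X := (c1 * (N `^ (eps - 1) * N `^ (4 / 3))) `^ (3 / 4).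
pose Y := (C2 * (N `^ eps * N ^+ 3 * V `^ d)) `^ (1 / 4).
have X0 : 0 < X by rewrite powR_gt0 // !mulr_gt0 ?powR_gt0.
have Y0 : 0 < Y by rewrite powR_gt0 // !mulr_gt0 ?powR_gt0 ?exprn_gt0.
have HX : (\sum_(n < M) cabs (v n)) `^ (4 / 3 - p) *
    \int[lebesgue_measure]_(x in `[0, 1]) cabs (trigpoly v M x) `^ p <=
      X `^ (4 / 3).
  have {HI} := HI N NN1; rewrite /moment counting_fun_indic // -/M -/v.
  rewrite (@eq_Rintegral01 _ _ (fun x => cabs (trigpoly v M x) `^ p)) =>
    [HI|x]; last first.
    by rewrite sum_upto_trigpoly.
  set S := \sum_(n < M) _ in SN HI *.
  have S0 : 0 <= S by apply: sumr_ge0 => i _; exact: cabs_ge0.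
  rewrite /X -powRrM (_ : 3 / 4 * (4 / 3) = 1); last by field.
  rewrite powRr1 ?mulr_ge0 ?powR_ge0 ?(ltW c10) //.
  apply: le_trans (_ : S `^ (4 / 3 - p) * (c1 * (N `^ (eps - 1) * S `^ p)) <=
    _).
    rewrite ler_wpM2l ?powR_ge0 //; apply: le_trans HI _.
    by rewrite ler_wpM2r ?mulr_ge0 ?powR_ge0 // le_max lexx.
  have -> : S `^ (4 / 3 - p) * (c1 * (N `^ (eps - 1) * S `^ p)) =
      c1 * (N `^ (eps - 1) * (S `^ (4 / 3 - p) * S `^ p)) by ring.
  rewrite -powRD; last first.
    by rewrite subrK mulf_eq0 invr_eq0 !pnatr_eq0.
  rewrite subrK ler_wpM2l ?(ltW c10) // ler_wpM2l ?powR_ge0 //.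
  by rewrite ge0_ler_powR ?nnegrE.
have Y4 : Y ^+ 4 = C2 * (N `^ eps * N ^+ 3 * V `^ d).
  rewrite -(powR_mulrn 4 (ltW Y0)) -powRrM (_ : 1 / 4 * 4%:R = 1);
    last by field.
  by rewrite powRr1 // !mulr_ge0 ?powR_ge0 ?exprn_ge0 // ltW.
have HY : \int[lebesgue_measure]_(x in `[0, 1])
    cabs (trigpoly (fun i => e (real_poly alpha i%:R)) M x) ^+ 4 <= Y ^+ 4.
  rewrite Y4; have Hpoly := polydiff_real_poly alpha.
  exact: (HJ _ _ _ _ _ q0 aq alq Hpoly N1' qM).
apply: le_trans (cabs_pairing_le X0 Y0 hp HX HY) _.
have -> : X * Y = c * (N `^ (1 + eps) * V `^ (d / 4)).
  have NE x y : N `^ x * N `^ y = N `^ (x + y).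
    by rewrite powRD // (gt_eqF N0) implybT.
  have N3 : N ^+ 3 = N `^ 3%:R by rewrite powR_mulrn.
  rewrite /X /Y N3 !NE !powRM ?mulr_ge0 ?powR_ge0 ?(ltW c10) ?(ltW C20) //.
  rewrite -!powRrM /c.
  have -> : N `^ (1 + eps) =
      N `^ ((eps - 1 + 4 / 3) * (3 / 4)) * N `^ ((eps + 3) * (1 / 4)).
    by rewrite NE; congr (_ `^ _); field.
  by rewrite mul1r; ring.
by rewrite mulrA ler_wpM2r // lerDr.
Qed.
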